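(* Let $\gamma>0$ and let $q\in L^1(0,\infty)$ be compactly supported, i.e. $\operatorname{supp}q\subset[0,Q]$ for some $Q>0$. Then there exists $R_0=R_0(q,\gamma)>0$ such that for every $R\ge R_0$, $$N(H_R)\le\frac{11}{\log2}\,\frac{\gamma R^2}{\log R}.$$
   Context: For $R>0$, $H_R=-\frac{d^2}{dx^2}+q+i\gamma\chi_{[0,R]}$ on $L^2(0,\infty)$ with Dirichlet boundary condition at $0$, $\chi_{[0,R]}$ the indicator of $[0,R]$. $N(H_R)$ denotes the number of (distinct) eigenvalues of $H_R$. *)

(* Defs.v *)
From HB Require Import structures.
From mathcomp Require Import all_boot all_order all_algebra.
From mathcomp Require Import all_classical all_reals all_analysis.
From mathcomp Require Import complex.

Set Implicit Arguments.
Unset Strict Implicit.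
Unset Printing Implicit Defensive.

Import Order.TTheory GRing.Theory Num.Theory.
Import numFieldNormedType.Exports.

Local Open Scope classical_set_scope.
Local Open Scope ring_scope.
Local Open Scope complex_scope.

Section Defs.
Variable R : realType.

Local Notation mu := (@lebesgue_measure R).

Definition halfline : set R := [set t | 0 <= t].
Definition seg (x : R) : set R := [set t | 0 <= t <= x].

Definition cintegrable (D : set R) (f : R -> R[i]) : Prop :=
  mu.-integrable D (fun t => (complex.Re (f t))%:E) /\
  mu.-integrable D (fun t => (complex.Im (f t))%:E).

Definition cintegral (D : set R) (f : R -> R[i]) : R[i] :=
  (Rintegral mu D (fun t => complex.Re (f t))) +i* (Rintegral mu D (fun t => complex.Im (f t))).

Definition csq_integrable (D : set R) (y : R -> R[i]) : Prop :=
  mu.-integrable D (fun t => ((complex.Re (y t)) ^+ 2 + (complex.Im (y t)) ^+ 2)%:E).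

Definition cderivable (y : R -> R[i]) (x : R) : Prop :=
  derivable (fun t => complex.Re (y t)) x 1 /\ derivable (fun t => complex.Im (y t)) x 1.

Definition cderive (y : R -> R[i]) (x : R) : R[i] :=
  (derive1 (fun t => complex.Re (y t)) x) +i* (derive1 (fun t => complex.Im (y t)) x).

Definition chi (r : R) (t : R) : R := if (0 <= t) && (t <= r) then 1 else 0.

(* lam is an eigenvalue of  -d^2/dx^2 + V  on L^2(0,oo) with Dirichlet
   boundary condition at 0: there is a nonzero y in L^2(0,oo), with y(0)=0,
   y in C^1 and y' absolutely continuous on compacts, such that
   -y'' + V y = lam y a.e.; the latter is expressed in integrated form
   y'(x) - y'(0) = \int_0^x (V - lam) y  for all x >= 0. *)
Definition is_eigenvalue (V : R -> R[i]) (lam : R[i]) : Prop :=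
  exists y : R -> R[i],
    [/\ exists x, 0 <= x /\ y x != 0,
        y 0 = 0,
        forall x, cderivable y x,
        csq_integrable halfline y &
        forall x, 0 <= x ->
          cintegrable (seg x) (fun t => (V t - lam) * y t) /\
          cderive y x - cderive y 0 = cintegral (seg x) (fun t => (V t - lam) * y t)].

Definition HR_potential (q : R -> R[i]) (gamma r : R) : R -> R[i] :=
  fun t => q t + 'i * (gamma * chi r t)%:C.

(* N(H) <= B : every finite family of distinct eigenvalues has at most B
   elements (equivalently the set of eigenvalues is finite, of cardinality <= B) *)
Definition num_eigenvalues_le (V : R -> R[i]) (B : R) : Prop :=
  forall s : seq R[i], uniq s -> (forall lam, lam \in s -> is_eigenvalue V lam) ->
    (size s)%:R <= B.

End Defs.

(* Main.v *)
(** An eigenvalue z^2, Im z >= 0, comes from a solution of -y'' + V y = z^2 y with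
    y(0) = 0, y'(0) = 1 and y'(R) = iz y(R), since V vanishes beyond R.  So z is a
    root of f(z) = y'(R) - iz y(R), an entire function of z which is the limit of
    polynomials f_n given by Picard iteration.

    With w^2 = z^2 - i gamma and w close to z, the functions y' + iwy and y' - iwy
    evolve almost freely on [0, R] when |w| is large, q being a small perturbation.
    As |z - w| <= gamma / |z|, the barrier amplifies the first one with respect to
    the second by at most exp(2 gamma R / |z|), which is at most R when
    |z| >= rho = 2 gamma R / log R; this is not enough to compensate for the ratio
    |z - w| / |z + w| of order |z|^-2, so f(z) <> 0.  Hence all roots lie in
    |z| < rho.  The same estimate shows that |f(i rho)| is about e^(rho R).

    The sum of |a_k| (5 rho)^k over the coefficients a_k of f_n is at most about
    e^(21/4 rho R), by a contraction argument for the majorant series.  Dividing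
    out the roots z_1, ..., z_N one at a time multiplies this norm by at most
    1 / (4 rho) and the value at i rho by 1 / |i rho - z_j| >= 1 / (2 rho).  This
    replaces Jensen's formula and gives 2^N <= e^(11/2 rho R). *)
Require Import Defs.
From HB Require Import structures.
From mathcomp Require Import all_boot all_order all_algebra.
From mathcomp Require Import all_classical all_reals all_analysis.
From mathcomp Require Import measurable_realfun.
From mathcomp Require Import complex ring lra.

Set Implicit Arguments.
Unset Strict Implicit.
Unset Printing Implicit Defensive.

Import Order.TTheory GRing.Theory Num.Theory.
Import numFieldNormedType.Exports.
Local Open Scope classical_set_scope.
Local Open Scope ring_scope.
Local Open Scope complex_scope.

(** * Absolutely continuous functions on a segment *)

Section RealPrimitive.
Variable R : realType.
Local Notation mu := (@lebesgue_measure R).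
Implicit Types (f g F G : R -> R) (x t X c : R).

(** The eigenvalue equation is given in integrated form with an integrable potential, so y'' exists
    only almost everywhere. Calculus is therefore done with pairs (F, f) such that F(x) = F(0) +
    \int_0^x f on a segment; their product rule comes from Fubini. The polynomials f_n let a
    weighted l^1 norm of coefficients play the part of the maximum modulus. The price is that the
    roots of f are only approximate roots of f_n, so every division leaves a remainder; it is
    multiplied by a constant depending on the roots alone and disappears as n grows. At i rho no
    exact solution is at hand, so the large-energy estimate is stated for F'' = (q - w^2) h with h
    close to F: h = F covers eigenfunctions, h the preceding iterate covers f_n. Constants: 21/4 = 5
    + 1/4, where 5 comes from the radius 5 rho and 1/4 pays for the lower order terms. The factor
    e^(rho R) gained at i rho pays for the prefactor 328 rho, and the loss e^(gamma R / rho) <=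
    e^(rho R / 4) turns 21/4 into 11/2. Inserting rho = 2 gamma R / log R yields 11. *)

Lemma segE x : seg x = `[0, x]%classic.
Proof. by apply/seteqP; split => t; rewrite /seg /= in_itv. Qed.

Lemma measurable_seg x : measurable (seg x : set (measurableTypeR R)).
Proof. by rewrite segE. Qed.
Hint Resolve measurable_seg : core.

Lemma mu_seg x : 0 <= x -> mu (seg x) = x%:E.
Proof.
move=> x0; rewrite segE lebesgue_measure_itv /= lte_fin.
case: ltP => [_|]; first by rewrite oppr0 adde0.
by move=> x0'; congr EFin; apply/le_anti/andP.
Qed.

Lemma subset_seg x X : x <= X -> seg x `<=` seg X.
Proof. by move=> xX t /andP[t0 tx]; rewrite /seg /= t0 (le_trans tx). Qed.

Definition seg_integrable X f := mu.-integrable (seg X) (fun t => (f t)%:E).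
Definition seg_integral f x := \int[mu]_(t in seg x) f t.

Lemma seg_integrable_sub x X f :
  x <= X -> seg_integrable X f -> seg_integrable x f.
Proof. by move=> xX; apply: integrableS => //; exact: (subset_seg xX). Qed.

Lemma seg_integrable_ext X f g :
  {in seg X, f =1 g} -> seg_integrable X f -> seg_integrable X g.
Proof.
move=> fg; apply: eq_integrable => // t tX.
by rewrite fg.
Qed.

Lemma seg_integrableD X f g :
  seg_integrable X f -> seg_integrable X g ->
  seg_integrable X (fun t => f t + g t).
Proof. by move=> fi gi; exact: (integrableD (measurable_seg X) fi gi). Qed.

Lemma seg_integrableZ X c f :
  seg_integrable X f -> seg_integrable X (fun t => c * f t).
Proof. by move=> fi; exact: (integrableZl (measurable_seg X) c fi). Qed.

Lemma seg_integrable_norm X f :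
  seg_integrable X f -> seg_integrable X (fun t => `|f t|).
Proof. by move=> fi; exact: integrable_norm. Qed.

Lemma seg_integrable_cst X c : seg_integrable X (fun=> c).
Proof.
apply: (@measurable_bounded_integrable _ _ _ mu (fun=> c)) => //; last exact: bounded_cst.
have [X0|X0] := ltP X 0; last first.
  by suff: (mu (seg X) < +oo)%E by []; rewrite (mu_seg X0) ltry.
by rewrite segE set_itv_ge ?measure0 ?ltry // -leNgt bnd_simp.
Qed.

Lemma seg_integral_ext f g x :
  {in seg x, f =1 g} -> seg_integral f x = seg_integral g x.
Proof. by move=> fg; exact: eq_Rintegral. Qed.

Lemma seg_integralD x f g : seg_integrable x f -> seg_integrable x g ->
  seg_integral (fun t => f t + g t) x = seg_integral f x + seg_integral g x.
Proof. by move=> fi gi; exact: RintegralD. Qed.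

Lemma seg_integralZ x c f : seg_integrable x f ->
  seg_integral (fun t => c * f t) x = c * seg_integral f x.
Proof. by move=> fi; exact: RintegralZl. Qed.

Lemma seg_integral_cst x c : 0 <= x -> seg_integral (fun=> c) x = c * x.
Proof. move=> x0; rewrite /seg_integral Rintegral_cst //; congr (c * _).
exact: (congr1 fine (mu_seg x0)). Qed.

Lemma seg_integral0 f : seg_integral f 0 = 0.
Proof. by rewrite /seg_integral segE set_itv1 Rintegral_set1. Qed.

Lemma le_seg_integral x f g : seg_integrable x f -> seg_integrable x g ->
  (forall t, 0 <= t <= x -> f t <= g t) -> seg_integral f x <= seg_integral g x.
Proof. by move=> fi gi fg; exact: le_Rintegral. Qed.

Lemma norm_seg_integral x f : seg_integrable x f ->
  `|seg_integral f x| <= seg_integral (fun t => `|f t|) x.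
Proof. by move=> fi; exact: le_normr_Rintegral. Qed.

Lemma seg_integral_ge0 x f : (forall t, 0 <= t <= x -> 0 <= f t) -> 0 <= seg_integral f x.
Proof. by move=> f0; exact: Rintegral_ge0. Qed.

Lemma seg_integral_trunc f x s : 0 <= s <= x -> seg_integrable x f ->
  seg_integral (fun t => if s <= t then f t else 0) x =
  seg_integral f x - seg_integral f s.
Proof.
move=> /andP[s0 sx] fi; rewrite /seg_integral !segE.
rewrite Rintegral_itvB; first last.
- by rewrite bnd_simp.
- by rewrite bnd_simp.
- by rewrite -segE.
rewrite Rintegral_itv_obnd_cbnd; last first.
  apply: integrableS fi => //; rewrite segE.
  by apply: subset_itvr; rewrite bnd_simp.
rewrite [RHS]Rintegral_mkcond [LHS]Rintegral_mkcond; apply: eq_Rintegral => t _.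
rewrite /patch !mem_setE !in_itv /=.
case: (leP s t) => st; case: (leP t x) => tx; rewrite ?andbF ?if_same //=.
by rewrite (le_trans s0 st).
Qed.

Lemma le_seg_integral_sub f x X : 0 <= x <= X -> seg_integrable X f ->
  (forall t, 0 <= t <= X -> 0 <= f t) -> seg_integral f x <= seg_integral f X.
Proof.
move=> xX fi f0; rewrite -subr_ge0 -seg_integral_trunc //.
by apply: seg_integral_ge0 => t tX; case: ifP => // _; exact: f0.
Qed.

(** Absolute continuity with the derivative carried as data, which fits an equation known only in
    integrated form. *)
Definition primitive_on X F f := seg_integrable X f /\
  forall x, 0 <= x <= X -> F x = F 0 + seg_integral f x.

Lemma primitive_on_sub x X F f : x <= X ->
  primitive_on X F f -> primitive_on x F f.
Proof.
move=> xX [fi FE]; split; first exact: seg_integrable_sub fi.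
by move=> t /andP[t0 tx]; apply: FE; rewrite t0 (le_trans tx).
Qed.

Lemma primitive_on_integral X f :
  seg_integrable X f -> primitive_on X (seg_integral f) f.
Proof. by move=> fi; split=> // x _; rewrite seg_integral0 add0r. Qed.

Lemma primitive_on_bounded X F f : primitive_on X F f ->
  forall x, 0 <= x <= X -> `|F x| <= `|F 0| + seg_integral (fun t => `|f t|) X.
Proof.
move=> [fi FE] x xX; have /andP[x0 xleX] := xX.
have fix_ := seg_integrable_sub xleX fi.
rewrite FE // (le_trans (ler_normD _ _)) // lerD2l.
rewrite (le_trans (norm_seg_integral fix_)) //.
by apply: le_seg_integral_sub => //; exact: seg_integrable_norm.
Qed.

Lemma primitive_on_continuous X F f : 0 <= X -> primitive_on X F f ->
  {within seg X, continuous F}.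
Proof.
move=> X0 [fi FE]; rewrite segE.
have c1 : {within `[0, X], continuous (fun x => F 0 + seg_integral f x)}.
  move=> x; apply: cvgD; first exact: cvg_cst.
  move: x.
  rewrite /seg_integrable segE in fi.
  have -> : seg_integral f = (fun x => \int[mu]_(t in `[0, x]) f t).
    by apply: boolp.funext => y; rewrite /seg_integral segE.
  exact: (parameterized_integral_continuous X0 fi).
apply: (subspace_eq_continuous _ c1) => x; rewrite inE /= in_itv => xX.
exact/esym/FE.
Qed.

Lemma primitive_on_measurable X F f : 0 <= X -> primitive_on X F f ->
  measurable_fun (seg X) F.
Proof.
move=> X0 FP; apply: subspace_continuous_measurable_fun.
  exact: measurable_seg.
exact: (primitive_on_continuous X0 FP).
Qed.

Lemma seg_integrableM X F f g : 0 <= X -> primitive_on X F f ->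
  seg_integrable X g -> seg_integrable X (fun t => F t * g t).
Proof.
move=> X0 FP gi; have mF := primitive_on_measurable X0 FP.
apply: (integrableMr (measurable_seg X) mF _ gi).
exists (`|F 0| + seg_integral (fun t => `|f t|) X); split; first exact: num_real.
move=> M MM t tX; apply: le_trans (ltW MM).
exact: (primitive_on_bounded FP).
Qed.

Lemma primitive_on_integrable X F f : 0 <= X -> primitive_on X F f ->
  seg_integrable X F.
Proof.
move=> X0 FP; have := seg_integrableM X0 FP (seg_integrable_cst X 1).
by apply: seg_integrable_ext => t _; rewrite mulr1.
Qed.

Lemma primitive_onD X F f G g : primitive_on X F f -> primitive_on X G g ->
  primitive_on X (fun t => F t + G t) (fun t => f t + g t).
Proof.
move=> [fi FE] [gi GE]; split; first exact: seg_integrableD.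
move=> x xX; have /andP[_ xleX] := xX; rewrite (FE x xX) (GE x xX).
rewrite (seg_integralD (seg_integrable_sub xleX fi) (seg_integrable_sub xleX gi)).
by rewrite addrACA.
Qed.

Lemma primitive_onZ X c F f : primitive_on X F f ->
  primitive_on X (fun t => c * F t) (fun t => c * f t).
Proof.
move=> [fi FE]; split; first exact: seg_integrableZ.
move=> x xX; have /andP[_ xleX] := xX; rewrite (FE x xX).
by rewrite (seg_integralZ c (seg_integrable_sub xleX fi)) mulrDr.
Qed.

Lemma primitive_on_cst X c : primitive_on X (fun=> c) (fun=> 0).
Proof.
split; first exact: seg_integrable_cst.
by move=> x /andP[x0 _]; rewrite seg_integral_cst // mul0r addr0.
Qed.

Lemma primitive_on_ext X F G f g : {in seg X, F =1 G} -> {in seg X, f =1 g} ->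
  primitive_on X F f -> primitive_on X G g.
Proof.
move=> FG fg [fi FE]; split; first exact: seg_integrable_ext fi.
move=> x xX; have /andP[x0 xleX] := xX.
have := FE x xX; rewrite !FG ?inE /seg /= ?lexx ?(le_trans x0 xleX) ?xX // => ->.
congr (_ + _); apply: seg_integral_ext => t; rewrite inE => tx.
by apply: fg; rewrite inE; exact: (subset_seg xleX).
Qed.


Lemma seg_integral_truncr f x t : 0 <= t <= x ->
  seg_integral (fun s => if s <= t then f s else 0) x = seg_integral f t.
Proof.
move=> /andP[t0 tx]; rewrite /seg_integral !segE.
rewrite [RHS]Rintegral_mkcond [LHS]Rintegral_mkcond; apply: eq_Rintegral => s _.
rewrite /patch !mem_setE !in_itv /=.
by case: (leP s t) => st; rewrite ?andbF ?if_same //= (le_trans st tx).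
Qed.

Lemma seg_integrable_if f x (P : R -> bool) : measurable_fun setT P ->
  seg_integrable x f -> seg_integrable x (fun t => if P t then f t else 0).
Proof.
move=> mP fi; have /integrableP[mf _] := fi.
apply: (le_integrable (measurable_seg x) _ _ fi) => //.
  apply/measurable_EFinP; apply: measurable_fun_if => //.
  - exact: measurable_funTS.
  - apply: (@measurable_funS _ _ _ _ (seg x)); first exact: measurable_seg.
      by move=> t [].
    by apply/measurable_EFinP.
by move=> t _; rewrite lee_fin; case: ifP => // _; rewrite normr0.
Qed.

Lemma integral_patch_seg f x c : seg_integrable x f ->
  (\int[mu]_t (c * (f \_ (seg x)) t)%:E = (c * seg_integral f x)%:E)%E.
Proof.
move=> fi; rewrite -(seg_integralZ c fi) /seg_integral /Rintegral fineK; last first.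
  exact: (integrable_fin_num (measurable_seg x) (seg_integrableZ c fi)).
rewrite [RHS]integral_mkcond; apply: eq_integral => t _.
by rewrite /patch; case: ifP => //; rewrite mulr0.
Qed.

Lemma patch_if f x (P : R -> bool) t :
  (if P t then (f \_ (seg x)) t else 0) =
  ((fun s => if P s then f s else 0) \_ (seg x)) t.
Proof. by rewrite /patch; case: (P t); case: ifP. Qed.

(* Fubini on the triangle s <= t of the square [0, x]^2 *)
Lemma seg_integral_triangle x f g : 0 <= x ->
  seg_integrable x f -> seg_integrable x g ->
  seg_integral (fun s => f s * (seg_integral g x - seg_integral g s)) x =
  seg_integral (fun t => g t * seg_integral f t) x.
Proof.
move=> x0 fi gi.
pose T := measurableTypeR R.
pose a : T -> R := f \_ (seg x); pose b : T -> R := g \_ (seg x).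
have ai : mu.-integrable [set: T] (EFin \o a).
  rewrite /a -restrict_EFin; apply/(integrable_restrict mu (measurable_seg x)) => //.
  by rewrite setTI.
have bi : mu.-integrable [set: T] (EFin \o b).
  rewrite /b -restrict_EFin; apply/(integrable_restrict mu (measurable_seg x)) => //.
  by rewrite setTI.
have ma : measurable_fun [set: T] a.
  by apply/measurable_EFinP; exact: measurable_int ai.
have mb : measurable_fun [set: T] b.
  by apply/measurable_EFinP; exact: measurable_int bi.
pose h (p : T * T) : R := if p.1 <= p.2 then a p.1 * b p.2 else 0.
have mh : measurable_fun [set: T * T] h.
  apply: measurable_fun_ifT => //.
  - by apply: measurable_fun_ler;
      [exact: measurable_fst|exact: measurable_snd].
  - apply: measurable_funM.
      by apply: measurableT_comp => //; exact: measurable_fst.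
    by apply: measurableT_comp => //; exact: measurable_snd.
have mhE : measurable_fun [set: T * T] (EFin \o h).
  exact/measurable_EFinP.
(* Tonelli: for fixed s the integral of |h(s, t)| over t is at most |a s| times the integral of |b|,
   and this is integrable in s. *)
have hi : (mu \x mu)%E.-integrable [set: T * T] (EFin \o h).
  apply/integrable12ltyP => //.
  have /integrableP[_ bfin] := bi.
  pose B := fine (\int[mu]_t `|(EFin \o b) t|)%E.
  have BE : (\int[mu]_t `|(EFin \o b) t| = B%:E)%E.
    by rewrite /B fineK // ge0_fin_numE // integral_ge0.
  have B0 : 0 <= B by rewrite -lee_fin -BE integral_ge0.
  have bnd (s : T) : (\int[mu]_t `|(EFin \o h) (s, t)| <= `|B%:E * `|a s|%:E|)%E.
    rewrite -EFinM gee0_abs ?lee_fin ?mulr_ge0 // EFinM -BE muleC -ge0_integralZl //; last first.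
      by do 2 apply: measurableT_comp => //.
    apply: ge0_le_integral => //.
    - apply: measurableT_comp => //; exact: (measurable_fun_pair2 s mhE).
    - by apply: measurable_funeM; do 2 apply: measurableT_comp => //.
    - move=> t _; rewrite /= -EFinM lee_fin /h /=.
      by case: ifP => _; rewrite ?normrM // normr0 mulr_ge0.
  have /integrableP[mBa Bafin] := integrableZl measurableT B (integrable_norm ai).
  apply: le_lt_trans Bafin; apply: ge0_le_integral => //.
  - by move=> s _; exact: integral_ge0.
  - apply: (measurable_fun_fubini_tonelli_F (abse \o (EFin \o h))).
    + exact: measurableT_comp.
    + by move=> p; exact: abse_ge0.
  - exact: measurableT_comp.
have inner1 s : (\int[mu]_t (h (s, t))%:E = (a s * (seg_integral g x - seg_integral g s))%:E)%E.
  transitivity (\int[mu]_t (a s * (((fun t => if s <= t then g t else 0) \_ (seg x)) t))%:E)%E.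
    apply: eq_integral => t _; rewrite -(patch_if g x (fun t => s <= t)) /h /=.
    by case: ifP => //; rewrite mulr0.
  rewrite integral_patch_seg; last first.
    by apply: seg_integrable_if => //; exact: measurable_fun_ler.
  rewrite /a /patch; case: ifPn => sx; last by rewrite !mul0r.
  by rewrite seg_integral_trunc //; move: sx; rewrite inE.
have inner2 t : (\int[mu]_s (h (s, t))%:E = (b t * seg_integral f t)%:E)%E.
  transitivity (\int[mu]_s (b t * (((fun s => if s <= t then f s else 0) \_ (seg x)) s))%:E)%E.
    apply: eq_integral => s _; rewrite -(patch_if f x (fun s => s <= t)) /h /=.
    by rewrite mulrC; case: ifP => //; rewrite ?mulr0 // mulrC.
  rewrite integral_patch_seg; last first.
    by apply: seg_integrable_if => //; exact: measurable_fun_ler.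
  rewrite /b /patch; case: ifPn => tx; last by rewrite !mul0r.
  by rewrite seg_integral_truncr //; move: tx; rewrite inE.
have := Fubini hi.
under eq_integral do rewrite inner1; under [in RHS]eq_integral do rewrite inner2.
move=> /(congr1 fine) FE.
rewrite /seg_integral [LHS]Rintegral_mkcond [RHS]Rintegral_mkcond.
transitivity (fine (\int[mu]_s (a s * (seg_integral g x - seg_integral g s))%:E)%E).
  congr fine; apply: eq_integral => s _; rewrite /a /patch.
  by case: ifP => //; rewrite mul0r.
rewrite FE; congr fine; apply: eq_integral => s _; rewrite /b /patch.
by case: ifP => //; rewrite mul0r.
Qed.

(** Once the constants F 0 and G 0 are split off, what remains is that the product of the integrals
    of f and g is the integral of f \int g + g \int f. This is the triangle identity. *)
Lemma primitive_onM X F f G g : 0 <= X ->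
  primitive_on X F f -> primitive_on X G g ->
  primitive_on X (fun t => F t * G t) (fun t => f t * G t + F t * g t).
Proof.
move=> X0 FP GP; have [fi FE] := FP; have [gi GE] := GP.
have fGi : seg_integrable X (fun t => f t * G t).
  apply: seg_integrable_ext (seg_integrableM X0 GP fi).
  by move=> t _; rewrite mulrC.
have Fgi := seg_integrableM X0 FP gi.
split; first exact: seg_integrableD.
move=> x xX; have /andP[x0 xleX] := xX.
have fix_ := seg_integrable_sub xleX fi; have gix := seg_integrable_sub xleX gi.
have FPx := primitive_on_integral fix_; have GPx := primitive_on_integral gix.
have i1 := seg_integrableM x0 FPx gix.
have i2 := seg_integrableM x0 GPx fix_.
have := seg_integral_triangle x0 fix_ gix.
have -> : seg_integral (fun s => f s * (seg_integral g x - seg_integral g s)) x =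
   seg_integral (fun s => seg_integral g x * f s + (-1) * (seg_integral g s * f s)) x.
  by apply: seg_integral_ext => s _; rewrite mulrBr mulN1r mulrC [f s * _]mulrC.
rewrite (seg_integralD (seg_integrableZ _ fix_) (seg_integrableZ _ i2)).
rewrite (seg_integralZ _ fix_) (seg_integralZ _ i2).
have -> : seg_integral (fun t => g t * seg_integral f t) x =
   seg_integral (fun t => seg_integral f t * g t) x.
  by apply: seg_integral_ext => s _; rewrite mulrC.
move=> tri.
have -> : seg_integral (fun t => f t * G t + F t * g t) x =
  seg_integral (fun t => (G 0 * f t + F 0 * g t) +
     (seg_integral g t * f t + seg_integral f t * g t)) x.
  apply: seg_integral_ext => t; rewrite inE => tx.
  have tX := subset_seg xleX tx.
  by rewrite (FE t tX) (GE t tX); ring.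
rewrite (seg_integralD (seg_integrableD (seg_integrableZ _ fix_) (seg_integrableZ _ gix))
  (seg_integrableD i2 i1)).
rewrite (seg_integralD (seg_integrableZ _ fix_) (seg_integrableZ _ gix)).
rewrite (seg_integralD i2 i1) (seg_integralZ _ fix_) (seg_integralZ _ gix) -tri.
by rewrite (FE x xX) (GE x xX); ring.
Qed.

End RealPrimitive.
#[export] Hint Resolve measurable_seg : core.

(** * Complex-valued absolutely continuous functions, two norms on C, and e^(iwx) *)

Section ComplexPrimitive.
Variable R : realType.
Local Notation mu := (@lebesgue_measure R).
Local Notation Re := (@complex.Re R).
Local Notation Im := (@complex.Im R).
Implicit Types (x t X : R) (z w : R[i]) (F G f g : R -> R[i]).

(* The l^1 norm of C = R^2 is submultiplicative, and its compatibility with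
   integrals reduces to the real and imaginary parts. *)
Definition taxi z : R := `|Re z| + `|Im z|.
(** The modulus as a real number; the norm [|z|] takes its values in [R[i]]. *)
Definition cmod z : R := Num.sqrt (Re z ^+ 2 + Im z ^+ 2).

Lemma taxi_ge0 z : 0 <= taxi z. Proof. by rewrite addr_ge0. Qed.

Lemma taxi0 : taxi 0 = 0. Proof. by rewrite /taxi /= normr0 addr0. Qed.

Lemma taxi_eq0 z : taxi z = 0 -> z = 0.
Proof.
move=> /eqP; rewrite paddr_eq0 // !normr_eq0 => /andP[/eqP a /eqP b].
by case: z a b => u v /= -> ->.
Qed.

Lemma taxiN z : taxi (- z) = taxi z.
Proof. by case: z => a b; rewrite /taxi /= !normrN. Qed.

Lemma taxiD z w : taxi (z + w) <= taxi z + taxi w.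
Proof.
case: z => a b; case: w => c d; rewrite /taxi /= addrACA.
by rewrite lerD // ler_normD.
Qed.

Lemma taxiB z w : taxi (z - w) <= taxi z + taxi w.
Proof. by rewrite (le_trans (taxiD _ _)) // taxiN. Qed.

Lemma taxiM z w : taxi (z * w) <= taxi z * taxi w.
Proof.
case: z => a b; case: w => c d; rewrite /taxi /=.
rewrite (le_trans (lerD (ler_normB _ _) (ler_normD _ _))) //.
by rewrite !normrM; lra.
Qed.

Lemma taxiZ (c : R) z : taxi (c%:C * z) = `|c| * taxi z.
Proof.
by case: z => a b; rewrite /taxi /= !mul0r subr0 addr0 !normrM mulrDr.
Qed.

Lemma cmodE z : `|z| = (cmod z)%:C. Proof. exact: normc_def. Qed.

Lemma cmod_ge0 z : 0 <= cmod z. Proof. exact: sqrtr_ge0. Qed.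

Lemma cmodM z w : cmod (z * w) = cmod z * cmod w.
Proof. by apply: complexI; rewrite -cmodE normrM !cmodE -rmorphM. Qed.

Lemma cmodD z w : cmod (z + w) <= cmod z + cmod w.
Proof. by have := ler_normD z w; rewrite !cmodE -rmorphD lecR. Qed.

Lemma cmodN z : cmod (- z) = cmod z.
Proof. by apply: complexI; rewrite -!cmodE normrN. Qed.

Lemma cmodB z w : cmod (z - w) <= cmod z + cmod w.
Proof. by rewrite (le_trans (cmodD _ _)) // cmodN. Qed.

Lemma cmodBr z w : cmod z - cmod w <= cmod (z - w).
Proof. by rewrite lerBlDr (le_trans _ (cmodD _ _)) // subrK. Qed.

Lemma cmod_sqr z : cmod z ^+ 2 = Re z ^+ 2 + Im z ^+ 2.
Proof. by rewrite sqr_sqrtr // addr_ge0 // sqr_ge0. Qed.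

Lemma cmod0 : cmod 0 = 0.
Proof. by apply: complexI; rewrite -cmodE normr0. Qed.

Lemma cmod1 : cmod 1 = 1.
Proof. by apply: complexI; rewrite -cmodE normr1. Qed.

Lemma cmod_real (c : R) : cmod c%:C = `|c|.
Proof. by rewrite /cmod /= expr0n /= addr0 sqrtr_sqr. Qed.

Lemma cmodi : cmod 'i = 1.
Proof. by rewrite /cmod /= expr0n /= add0r expr1n sqrtr1. Qed.

Lemma cmod_taxi z : cmod z <= taxi z.
Proof.
rewrite -(@ler_pXn2r _ 2) ?nnegrE ?cmod_ge0 ?taxi_ge0 //.
rewrite cmod_sqr /taxi sqrrD !real_normK ?num_real //.
by rewrite -addrA lerD2l lerDr mulrn_wge0 // mulr_ge0.
Qed.

Lemma Re_cmod z : `|Re z| <= cmod z.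
Proof.
rewrite -(@ler_pXn2r _ 2) ?nnegrE ?cmod_ge0 //.
by rewrite cmod_sqr real_normK ?num_real // lerDl sqr_ge0.
Qed.

Lemma Im_cmod z : `|Im z| <= cmod z.
Proof.
rewrite -(@ler_pXn2r _ 2) ?nnegrE ?cmod_ge0 //.
by rewrite cmod_sqr real_normK ?num_real // lerDr sqr_ge0.
Qed.

Lemma taxi_cmod z : taxi z <= 2 * cmod z.
Proof. by rewrite mulr_natl mulr2n lerD ?Re_cmod ?Im_cmod. Qed.

Definition cprimitive_on X F f :=
  primitive_on X (fun t => Re (F t)) (fun t => Re (f t)) /\
  primitive_on X (fun t => Im (F t)) (fun t => Im (f t)).

Definition cseg_integral f x : R[i] :=
  seg_integral (fun t => Re (f t)) x +i* seg_integral (fun t => Im (f t)) x.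

Definition cseg_integrable X f :=
  seg_integrable X (fun t => Re (f t)) /\ seg_integrable X (fun t => Im (f t)).

Lemma cprimitive_on_integrable X F f : cprimitive_on X F f -> cseg_integrable X f.
Proof. by move=> [[a _] [b _]]. Qed.

Lemma cprimitive_on_integral X f c :
  cseg_integrable X f -> cprimitive_on X (fun x => c + cseg_integral f x) f.
Proof.
case: c => u v [a b]; split.
  have := primitive_onD (primitive_on_cst X u) (primitive_on_integral a).
  by apply: primitive_on_ext => t _ //=; rewrite add0r.
have := primitive_onD (primitive_on_cst X v) (primitive_on_integral b).
by apply: primitive_on_ext => t _ //=; rewrite add0r.
Qed.

Lemma cseg_integral0 f : cseg_integral f 0 = 0.
Proof. by rewrite /cseg_integral !seg_integral0. Qed.

Lemma cprimitive_on_sub x X F f : x <= X ->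
  cprimitive_on X F f -> cprimitive_on x F f.
Proof. by move=> xX [a b]; split; exact: primitive_on_sub xX _. Qed.

Lemma cprimitive_on_ext X F G f g :
  (forall t, 0 <= t <= X -> F t = G t) -> (forall t, 0 <= t <= X -> f t = g t) ->
  cprimitive_on X F f -> cprimitive_on X G g.
Proof.
move=> FG fg [a b]; split.
  by apply: primitive_on_ext a => t; rewrite inE => tX; rewrite ?FG ?fg.
by apply: primitive_on_ext b => t; rewrite inE => tX; rewrite ?FG ?fg.
Qed.

Lemma cprimitive_onD X F f G g : cprimitive_on X F f -> cprimitive_on X G g ->
  cprimitive_on X (fun t => F t + G t) (fun t => f t + g t).
Proof.
move=> [a b] [c d]; split.
  by apply: primitive_on_ext (primitive_onD a c) => t _; rewrite raddfD.
by apply: primitive_on_ext (primitive_onD b d) => t _; rewrite raddfD.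
Qed.

Lemma cprimitive_onM X F f G g : 0 <= X ->
  cprimitive_on X F f -> cprimitive_on X G g ->
  cprimitive_on X (fun t => F t * G t) (fun t => f t * G t + F t * g t).
Proof.
move=> X0 [a b] [c d]; split.
  apply: primitive_on_ext (primitive_onD (primitive_onM X0 a c)
    (primitive_onZ (-1) (primitive_onM X0 b d))) => t _ /=.
    by case: (F t) => ? ?; case: (G t) => ? ? /=; ring.
  case: (F t) => ? ?; case: (G t) => ? ?.
  by case: (f t) => ? ?; case: (g t) => ? ? /=; ring.
apply: primitive_on_ext (primitive_onD (primitive_onM X0 a d)
  (primitive_onM X0 b c)) => t _ /=.
  by case: (F t) => ? ?; case: (G t) => ? ? /=; ring.
case: (F t) => ? ?; case: (G t) => ? ?.
by case: (f t) => ? ?; case: (g t) => ? ? /=; ring.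
Qed.

Lemma cprimitive_on_cst X (c : R[i]) : cprimitive_on X (fun=> c) (fun=> 0).
Proof. by split; exact: primitive_on_cst. Qed.

Lemma cprimitive_onZ X (c : R[i]) F f : 0 <= X -> cprimitive_on X F f ->
  cprimitive_on X (fun t => c * F t) (fun t => c * f t).
Proof.
move=> X0 FP; have := cprimitive_onM X0 (cprimitive_on_cst X c) FP.
by apply: cprimitive_on_ext => t _ //; rewrite mul0r add0r.
Qed.

Lemma cprimitive_onB X F f G g : 0 <= X ->
  cprimitive_on X F f -> cprimitive_on X G g ->
  cprimitive_on X (fun t => F t - G t) (fun t => f t - g t).
Proof.
move=> X0 FP GP; have := cprimitive_onD FP (cprimitive_onZ (-1) X0 GP).
by apply: cprimitive_on_ext => t _; rewrite mulN1r.
Qed.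

Lemma cprimitive_on_sum X (I : Type) (s : seq I) (F f : I -> R -> R[i]) :
  (forall i, cprimitive_on X (F i) (f i)) ->
  cprimitive_on X (fun t => \sum_(i <- s) F i t) (fun t => \sum_(i <- s) f i t).
Proof.
move=> FP; elim: s => [|i s IH].
  by apply: cprimitive_on_ext (cprimitive_on_cst X 0) => t _; rewrite big_nil.
by apply: cprimitive_on_ext (cprimitive_onD (FP i) IH) => t _; rewrite big_cons.
Qed.

Lemma cseg_integrableM X F f g : 0 <= X -> cprimitive_on X F f ->
  cseg_integrable X g -> cseg_integrable X (fun t => F t * g t).
Proof.
move=> X0 FP gi.
have [FPr FPi] := FP; have [gr gim] := gi; split.
  apply: seg_integrable_ext (seg_integrableD (seg_integrableM X0 FPr gr)
    (seg_integrableZ (-1) (seg_integrableM X0 FPi gim))) => t _.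
  by case: (F t) => ? ?; case: (g t) => ? ? /=; ring.
apply: seg_integrable_ext (seg_integrableD (seg_integrableM X0 FPr gim)
    (seg_integrableM X0 FPi gr)) => t _.
by case: (F t) => ? ?; case: (g t) => ? ? /=; ring.
Qed.

Lemma cseg_integrableD X f g : cseg_integrable X f -> cseg_integrable X g ->
  cseg_integrable X (fun t => f t + g t).
Proof.
move=> [a b] [c d]; split.
  by apply: seg_integrable_ext (seg_integrableD a c) => t _; rewrite raddfD.
by apply: seg_integrable_ext (seg_integrableD b d) => t _; rewrite raddfD.
Qed.

Lemma cseg_integrable_cst X (c : R[i]) : cseg_integrable X (fun=> c).
Proof. by split; exact: seg_integrable_cst. Qed.

Lemma cprimitive_cseg_integrable X F f : 0 <= X -> cprimitive_on X F f ->
  cseg_integrable X F.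
Proof. by move=> X0 [a b]; split; apply: primitive_on_integrable; eassumption. Qed.

Lemma taxi_integrable X f : cseg_integrable X f ->
  seg_integrable X (fun t => taxi (f t)).
Proof. by move=> [a b]; apply: seg_integrableD; exact: seg_integrable_norm. Qed.

Lemma cprimitive_bound X F f (b : R -> R) x : cprimitive_on X F f ->
  0 <= x <= X -> seg_integrable x b ->
  (forall t, 0 <= t <= x -> taxi (f t) <= b t) ->
  taxi (F x - F 0) <= seg_integral b x.
Proof.
move=> FP xX bi fb; have /andP[x0 xleX] := xX.
have [[fr FrE] [fim FiE]] := cprimitive_on_sub xleX FP.
have xx : 0 <= x <= x by rewrite x0 lexx.
have -> : taxi (F x - F 0) = `|seg_integral (fun t => Re (f t)) x| +
   `|seg_integral (fun t => Im (f t)) x|.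
  rewrite /taxi !raddfB /= (FrE x xx) (FiE x xx).
  by rewrite addrAC subrr add0r addrAC subrr add0r.
rewrite (le_trans (lerD (norm_seg_integral fr) (norm_seg_integral fim))) //.
rewrite -(seg_integralD (seg_integrable_norm fr) (seg_integrable_norm fim)).
by apply: le_seg_integral => //; apply: seg_integrableD; exact: seg_integrable_norm.
Qed.

Lemma cprimitive_on_bounded X F f : cprimitive_on X F f ->
  exists2 M, 0 <= M & forall x, 0 <= x <= X -> taxi (F x) <= M.
Proof.
move=> FP; have [[fr FrE] [fim FiE]] := FP.
exists (taxi (F 0) + seg_integral (fun t => taxi (f t)) X).
  by rewrite addr_ge0 ?taxi_ge0 // seg_integral_ge0 // => t _; exact: taxi_ge0.
move=> x xX; have /andP[x0 xleX] := xX.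
have fi := taxi_integrable (cprimitive_on_integrable FP).
have := cprimitive_bound FP xX (seg_integrable_sub xleX fi) (fun t _ => lexx _).
have := taxiD (F x - F 0) (F 0); rewrite subrK.
have := le_seg_integral_sub xX fi (fun t _ => taxi_ge0 _).
by lra.
Qed.

Lemma cprimitive_on0 X F f : cprimitive_on X F f ->
  (forall t, 0 <= t <= X -> f t = 0) -> forall x, 0 <= x <= X -> F x = F 0.
Proof.
move=> FP f0 x xX; have /andP[x0 _] := xX.
have : taxi (F x - F 0) <= seg_integral (fun=> 0) x.
  apply: (cprimitive_bound FP xX); first exact: seg_integrable_cst.
  move=> t /andP[t0 tx]; rewrite f0 ?taxi0 // t0 (le_trans tx) //.
  by have /andP[] := xX.
rewrite seg_integral_cst // mul0r => le0; apply/eqP; rewrite -subr_eq0; apply/eqP.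
by apply: taxi_eq0; apply/le_anti; rewrite le0 taxi_ge0.
Qed.

(** Turns pointwise derivatives into the integral form. It serves for the exponentials and for an
    eigenfunction y, whose derivative is continuous. *)
Lemma primitive_on_derivable X (F f : R -> R) : 0 <= X ->
  (forall x, derivable F x 1) -> {within seg X, continuous f} ->
  (forall x, 0 <= x <= X -> derive1 F x = f x) -> primitive_on X F f.
Proof.
move=> X0 dF cf F'f; rewrite segE in cf; split.
  rewrite /seg_integrable segE; apply: continuous_compact_integrable => //.
  exact: segment_compact.
move=> x /andP[x0 xX]; move: x0; rewrite le_eqVlt => /predU1P[<-|x0].
  by rewrite seg_integral0 addr0.
have cF y : {for y, continuous F}.
  by apply/differentiable_continuous/derivable1_diffP.
have := @continuous_FTC2 R f F 0 x x0.
rewrite /seg_integral segE /Rintegral => ->; first by rewrite /= addrCA subrr addr0.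
- by apply: continuous_subspaceW cf; apply: subset_itvl; rewrite bnd_simp.
- split.
  + by move=> y _; exact: dF.
  + by apply: cvg_at_right_filter; exact: cF.
  + by apply: cvg_at_left_filter; exact: cF.
- move=> y; rewrite in_itv /= => /andP[y0 yx]; apply: F'f.
  by rewrite (ltW y0) (le_trans (ltW yx)).
Qed.

(* e^(iwx) *)
Definition cexp w x : R[i] := (expR (- (Im w * x)))%:C * (cos (Re w * x) +i* sin (Re w * x)).

Lemma cexp0 w : cexp w 0 = 1.
Proof. by rewrite /cexp !mulr0 oppr0 expR0 cos0 sin0 mul1r. Qed.

Lemma cexpD w z x : cexp (w + z) x = cexp w x * cexp z x.
Proof.
case: w => a b; case: z => c d; rewrite /cexp /=.
rewrite !mulrDl opprD expRD cosD sinD.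
by apply/eqP; rewrite eq_complex /=; apply/andP; split; apply/eqP; ring.
Qed.

Lemma cexpNK w x : cexp w x * cexp (- w) x = 1.
Proof.
rewrite -cexpD subrr /cexp /= !mul0r oppr0 expR0 cos0 sin0.
by rewrite mul1r.
Qed.

Lemma cmod_cexp w x : cmod (cexp w x) = expR (- (Im w * x)).
Proof.
rewrite cmodM cmod_real ger0_norm ?expR_ge0 //.
by rewrite /cmod /= cos2Dsin2 sqrtr1 mulr1.
Qed.

Lemma cprimitive_on_cexp X w : 0 <= X ->
  cprimitive_on X (cexp w) (fun t => 'i * w * cexp w t).
Proof.
move=> X0; case: w => a b.
pose Er (x : R) := expR (- (b * x)) * cos (a * x).
pose Ei (x : R) := expR (- (b * x)) * sin (a * x).
have dE x : is_derive x 1 (fun t => expR (- (b * t))) (- b * expR (- (b * x))).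
  have d1 : is_derive x 1 (fun t : R => - (b * t)) (- b).
    rewrite (_ : (fun t : R => - (b * t)) = ( *%R (- b))); last first.
      by apply: boolp.funext => t; rewrite mulNr.
    by apply: is_derive_eq; rewrite /GRing.scale /= mulr1.
  by have := is_derive1_comp (is_derive_expR _) d1; rewrite mulrC.
have dax x : is_derive x 1 (fun t : R => a * t) a.
  by apply: is_derive_eq; rewrite /GRing.scale /= mulr1.
have dC x : is_derive x 1 (fun t => cos (a * t)) (- (a * sin (a * x))).
  by have := is_derive1_comp (is_derive_cos _) (dax x); rewrite mulNr mulrC.
have dS x : is_derive x 1 (fun t => sin (a * t)) (a * cos (a * x)).
  by have := is_derive1_comp (is_derive_sin _) (dax x); rewrite mulrC.
(* The two equations for [Er] and [Ei] are E' = i w E in real coordinates, as i w = -b + i a. *)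
have dr x : is_derive x 1 Er (- b * Er x - a * Ei x).
  have := is_deriveM (dE x) (dC x); rewrite /GRing.scale /= => d.
  by apply: is_derive_eq; rewrite /Er /Ei; ring.
have di x : is_derive x 1 Ei (a * Er x - b * Ei x).
  have := is_deriveM (dE x) (dS x); rewrite /GRing.scale /= => d.
  by apply: is_derive_eq; rewrite /Er /Ei; ring.
have cEr y : {for y, continuous Er}.
  by apply/differentiable_continuous/derivable1_diffP; case: (dr y).
have cEi y : {for y, continuous Ei}.
  by apply/differentiable_continuous/derivable1_diffP; case: (di y).
have cl (u v : R) : {within seg X, continuous (fun x => u * Er x + v * Ei x)}.
  by apply: continuous_subspaceT => y; apply: cvgD; apply: cvgM => //;
    first [exact: cvg_cst|exact: cEr|exact: cEi].
have P1 : primitive_on X Er (fun x => - b * Er x + (- a) * Ei x).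
  apply: primitive_on_derivable => //.
  by move=> x _; rewrite derive1E (mulNr a); case: (dr x).
have P2 : primitive_on X Ei (fun x => a * Er x + (- b) * Ei x).
  apply: primitive_on_derivable => //.
  by move=> x _; rewrite derive1E (mulNr b); case: (di x).
split.
  by apply: primitive_on_ext P1 => t _; rewrite /Er /Ei /cexp /=; ring.
by apply: primitive_on_ext P2 => t _; rewrite /Er /Ei /cexp /=; ring.
Qed.


End ComplexPrimitive.

(** * Zeros of polynomials in a weighted l^1 norm *)

Section PolyNorm.
Variable C : numFieldType.
Implicit Types (p q : {poly C}) (s z c : C).

(** Substitute for the maximum of |p| on the disc of radius s: it dominates |p| there and behaves
    well under division by X - z. *)
Definition poly_norm p s := \sum_(i < size p) `|p`_i| * s ^+ i.

Lemma poly_norm_wide n p s : (size p <= n)%N ->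
  poly_norm p s = \sum_(i < n) `|p`_i| * s ^+ i.
Proof.
move=> pn; rewrite /poly_norm (big_ord_widen _ (fun i => `|p`_i| * s ^+ i) pn) big_mkcond /=.
apply: eq_bigr => i _; case: ltnP => // ip.
by rewrite nth_default // normr0 mul0r.
Qed.

Lemma poly_norm_ge0 p s : 0 <= s -> 0 <= poly_norm p s.
Proof. by move=> s0; rewrite sumr_ge0 // => i _; rewrite mulr_ge0 ?exprn_ge0. Qed.

Lemma poly_norm0 s : poly_norm 0 s = 0.
Proof. by rewrite /poly_norm size_poly0 big_ord0. Qed.

Lemma poly_normD p q s : 0 <= s -> poly_norm (p + q) s <= poly_norm p s + poly_norm q s.
Proof.
move=> s0; pose n := maxn (size p) (size q).
rewrite (@poly_norm_wide n (p + q)) ?size_polyD //.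
rewrite (@poly_norm_wide n p) ?leq_maxl // (@poly_norm_wide n q) ?leq_maxr //.
rewrite -big_split /= ler_sum // => i _.
by rewrite coefD -mulrDl ler_wpM2r ?exprn_ge0 ?ler_normD.
Qed.

Lemma poly_norm_sum (I : Type) (r : seq I) (h : I -> {poly C}) s : 0 <= s ->
  poly_norm (\sum_(i <- r) h i) s <= \sum_(i <- r) poly_norm (h i) s.
Proof.
move=> s0; elim/big_ind2: _ => [|a b c d ab cd|//]; first by rewrite poly_norm0.
by rewrite (le_trans (poly_normD _ _ s0)) // lerD.
Qed.

Lemma poly_norm_monomial c n s : poly_norm (c *: 'X^n) s = `|c| * s ^+ n.
Proof.
rewrite (@poly_norm_wide n.+1); last first.
  by rewrite (leq_trans (size_scale_leq _ _)) // size_polyXn.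
rewrite big_ord_recr /= big1 ?add0r => [|i _]; last first.
  by rewrite coefZ coefXn (ltn_eqF (ltn_ord i)) mulr0 normr0 mul0r.
by rewrite coefZ coefXn eqxx mulr1.
Qed.

Lemma poly_norm_MXaddC q c s : poly_norm (q * 'X + c%:P) s = s * poly_norm q s + `|c|.
Proof.
rewrite (@poly_norm_wide (size q).+1); last first.
  by rewrite size_MXaddC; case: ifP.
rewrite big_ord_recl /= expr0 mulr1 addrC; congr (_ + _).
  by rewrite mulr_sumr; apply: eq_bigr => i _; rewrite coefD coefMX coefC /= addr0 exprS mulrCA.
by rewrite coefD coefMX coefC /= add0r.
Qed.

Lemma horner_poly_norm p z s : `|z| <= s -> `|p.[z]| <= poly_norm p s.
Proof.
move=> zs; elim/poly_ind: p => [|q c IH]; first by rewrite horner0 normr0 poly_norm0.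
rewrite poly_norm_MXaddC hornerMXaddC (le_trans (ler_normD _ _)) // lerD2r normrM mulrC.
by rewrite ler_pM.
Qed.

(** For X^n the quotient is \sum z^(n-1-k) X^k, and d \sum s^(n-1-k) (s+d)^k = (s+d)^n - s^n. The
    induction follows Horner's scheme; the extra term [poly_norm p s] is what bounds the new
    coefficient q(z) of the quotient. *)
Lemma poly_divX_norm p z s d : 0 <= d -> 0 <= s -> `|z| <= s ->
  exists2 g, p = (p.[z])%:P + ('X - z%:P) * g &
    d * poly_norm g (s + d) + poly_norm p s <= poly_norm p (s + d).
Proof.
move=> d0 s0 zs; elim/poly_ind: p => [|q c [g qE IH]].
  by exists 0; rewrite ?horner0 ?mulr0 ?addr0 // !poly_norm0 mulr0 addr0.
exists (g * 'X + (q.[z])%:P).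
  rewrite hornerMXaddC {1}qE !polyCD polyCM; ring.
rewrite !poly_norm_MXaddC.
have qz := horner_poly_norm q zs.
have g0 := poly_norm_ge0 g (addr_ge0 s0 d0).
have -> : (s + d) * poly_norm q (s + d) + `|c| =
  (s + d) * poly_norm q (s + d) - (s + d) * (d * poly_norm g (s + d) + poly_norm q s)
  + ((s + d) * (d * poly_norm g (s + d)) + (s + d) * poly_norm q s + `|c|) by ring.
rewrite -mulrBr.
have H1 : 0 <= (s + d) * (poly_norm q (s + d) - (d * poly_norm g (s + d) + poly_norm q s)).
  by apply: mulr_ge0; [exact: addr_ge0|rewrite subr_ge0].
have H2 : d * `|q.[z]| <= d * poly_norm q s by rewrite ler_wpM2l.
rewrite -subr_ge0.
rewrite [X in 0 <= X](_ : _ = (s + d) *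
  (poly_norm q (s + d) - (d * poly_norm g (s + d) + poly_norm q s)) +
  (d * poly_norm q s - d * `|q.[z]|)); last by ring.
by rewrite addr_ge0 // subr_ge0.
Qed.

(* Jensen-type inequality at the point c, with an error term accounting for
   the fact that p vanishes only approximately at the points of zs. *)
Lemma poly_zeros_bound (zs : seq C) (c s d D : C) : 0 < d -> 0 <= s -> 0 <= D -> uniq zs ->
  (forall z, z \in zs -> `|z| <= s /\ `|c - z| <= D) -> `|c| <= s + d ->
  exists2 K, 0 <= K & forall p, `|p.[c]| <=
    (D / d) ^+ size zs * poly_norm p (s + d) + K * \sum_(z <- zs) `|p.[z]|.
Proof.
move=> d0 s0 D0 + + cs; elim: zs => [_ _|z zs IH /= /andP[zzs uzs] Hz].
  by exists 0 => // p; rewrite mul0r addr0 expr0 mul1r horner_poly_norm.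
have [|K K0 HK] := IH uzs; first by move=> y yzs; apply: Hz; rewrite inE yzs orbT.
have [zs1 cz] := Hz z (mem_head _ _).
(* At y the quotient takes the value (p(y) - p(z)) / (y - z), so M controls how the errors at the
   remaining points grow. It depends on the points only, hence K can be chosen before p. *)
pose M := \sum_(y <- zs) `|y - z|^-1.
have M0 : 0 <= M by rewrite /M sumr_ge0 // => y _; rewrite invr_ge0.
exists (1 + D * K * (M * 2)).
  by rewrite addr_ge0 // !mulr_ge0.
move=> p; have [g pE gp] := poly_divX_norm p (ltW d0) s0 zs1.
have sd0 : 0 <= s + d by rewrite addr_ge0 // ltW.
have gE y : p.[y] = p.[z] + (y - z) * g.[y].
  by rewrite {1}pE !hornerE.
have gb : poly_norm g (s + d) <= poly_norm p (s + d) / d.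
  rewrite ler_pdivlMr // mulrC (le_trans _ gp) // lerDl poly_norm_ge0 //.
set S := \sum_(y <- zs) `|p.[y]|; set A := `|p.[z]|.
have S0 : 0 <= S by rewrite /S sumr_ge0.
have A0 : 0 <= A by rewrite /A.
have sg : \sum_(y <- zs) `|g.[y]| <= M * (S + A).
  rewrite /M mulr_suml big_seq [leRHS]big_seq ler_sum // => y yzs.
  have yz : y - z != 0.
    by rewrite subr_eq0; apply: contraNneq zzs => <-.
  have -> : g.[y] = (y - z)^-1 * (p.[y] - p.[z]).
    by rewrite (gE y) addrAC subrr add0r mulKf.
  rewrite normrM normfV ler_wpM2l ?invr_ge0 // (le_trans (ler_normB _ _)) // lerD2r.
  rewrite /S (big_rem y) //= lerDl sumr_ge0 //.
rewrite big_cons -/S -/A exprS (gE c) (le_trans (ler_normD _ _)) // normrM.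
have step : `|c - z| * `|g.[c]| <=
   D * ((D / d) ^+ size zs * (poly_norm p (s + d) / d) + K * (M * (S + A))).
  apply: ler_pM => //; apply: le_trans (HK g) _; apply: lerD.
    by rewrite ler_wpM2l // exprn_ge0 // divr_ge0 // ltW.
  by rewrite ler_wpM2l.
apply: le_trans (lerD (lexx _) step) _; rewrite -/A -subr_ge0.
rewrite [X in 0 <= X](_ : _ = S + D * K * M * (A + S)); last by ring.
by rewrite addr_ge0 // !mulr_ge0 // addr_ge0.
Qed.

End PolyNorm.

(** * Picard iteration *)

Section Volterra.
Variable R : realType.
Local Notation Re := (@complex.Re R).
Local Notation Im := (@complex.Im R).
Implicit Types (x t X k : R) (z w : R[i]) (F G f g : R -> R[i]).

Lemma primitive_on_expR X k : 0 <= X ->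
  primitive_on X (fun t => expR (k * t)) (fun t => k * expR (k * t)).
Proof.
move=> X0.
have dE x : is_derive x 1 (fun t => expR (k * t)) (k * expR (k * x)).
  have d1 : is_derive x 1 (fun t : R => k * t) k.
    by apply: is_derive_eq; rewrite /GRing.scale /= mulr1.
  by have := is_derive1_comp (is_derive_expR _) d1; rewrite mulrC.
have cE y : {for y, continuous (fun t => expR (k * t))}.
  by apply/differentiable_continuous/derivable1_diffP; case: (dE y).
apply: primitive_on_derivable => //.
  apply: continuous_subspaceT => y; apply: cvgM; first exact: cvg_cst.
  exact: cE.
by move=> x _; rewrite derive1E; case: (dE x).
Qed.

Lemma exp_integrable x k (Q : R -> R) : 0 <= x -> seg_integrable x Q ->
  seg_integrable x (fun t => Q t * expR (k * t)).
Proof.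
move=> x0 Qi; apply: seg_integrable_ext (seg_integrableM x0 (primitive_on_expR k x0) Qi).
by move=> t _; rewrite mulrC.
Qed.

(** The bounded part L of the potential gains a factor 1/k from the exponential weight, while the
    merely integrable part contributes its L^1 norm. *)
Lemma exp_integral_le x k (L : R) (Q : R -> R) : 0 <= x -> 0 < k -> 0 <= L ->
  (forall t, 0 <= Q t) -> seg_integrable x Q ->
  seg_integral (fun t => (Q t + L) * expR (k * t)) x <=
  (seg_integral Q x + L / k) * expR (k * x).
Proof.
move=> x0 k0 L0 Q0 Qi.
have E0 : seg_integrable x (fun t => expR (k * t)).
  exact: primitive_on_integrable x0 (primitive_on_expR k x0).
have [kEi kE] := primitive_on_expR k x0.
have xx : 0 <= x <= x by rewrite x0 lexx.
have -> : seg_integral (fun t => (Q t + L) * expR (k * t)) x =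
  seg_integral (fun t => Q t * expR (k * t) + (L / k) * (k * expR (k * t))) x.
  apply: seg_integral_ext => t _; rewrite mulrDl; congr (_ + _).
  by rewrite mulrA mulfVK // gt_eqF.
rewrite (seg_integralD (exp_integrable k x0 Qi) (seg_integrableZ _ kEi)).
rewrite (seg_integralZ _ kEi) mulrDl lerD //; last first.
  rewrite ler_wpM2l ?divr_ge0 // 1?ltW //.
  by have := kE x xx; rewrite mulr0 expR0 => ->; lra.
have -> : seg_integral Q x * expR (k * x) = seg_integral (fun t => expR (k * x) * Q t) x.
  by rewrite (seg_integralZ _ Qi) mulrC.
apply: le_seg_integral; [exact: exp_integrable|exact: seg_integrableZ|].
move=> t /andP[t0 tx]; rewrite mulrC ler_wpM2r // ler_expR ler_wpM2l //.
exact: ltW.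
Qed.

Lemma cprimitive_exp_bound X k (L D : R) (Q : R -> R) F f :
  0 < k -> 0 <= L -> 0 <= D -> (forall t, 0 <= Q t) -> seg_integrable X Q ->
  cprimitive_on X F f -> F 0 = 0 ->
  (forall t, 0 <= t <= X -> taxi (f t) <= (Q t + L) * (D * expR (k * t))) ->
  forall x, 0 <= x <= X ->
  taxi (F x) <= D * (seg_integral Q X + L / k) * expR (k * x).
Proof.
move=> k0 L0 D0 Q0 Qi FP F0 fb x xX; have /andP[x0 xleX] := xX.
have Qix := seg_integrable_sub xleX Qi.
have QLi : seg_integrable x (fun t => Q t + L).
  exact: seg_integrableD Qix (seg_integrable_cst _ _).
rewrite -[F x]subr0 -F0.
have bi := seg_integrableZ D (exp_integrable k x0 QLi).
apply: le_trans (cprimitive_bound FP xX bi _) _.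
  move=> t /andP[t0 tx]; apply: le_trans (fb t _) _.
    by rewrite t0 (le_trans tx).
  by rewrite mulrCA.
rewrite (seg_integralZ D (exp_integrable k x0 QLi)) -mulrA ler_wpM2l //.
apply: le_trans (exp_integral_le x0 k0 L0 Q0 Qix) _.
rewrite ler_wpM2r ?expR_ge0 // lerD2r; apply: le_seg_integral_sub => //.
Qed.

(* iterating y |-> \int\int W y contracts in the norm sup |y(x)| e^(-k x) for large k *)
Lemma volterra_contraction X (W : R -> R[i]) (d d' : nat -> R -> R[i]) (M : R) :
  0 <= X -> cseg_integrable X W ->
  (forall n, cprimitive_on X (d n.+1) (d' n.+1)) ->
  (forall n, cprimitive_on X (d' n.+1) (fun t => W t * d n t)) ->
  (forall n, d n.+1 0 = 0 /\ d' n.+1 0 = 0) ->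
  0 <= M -> (forall x, 0 <= x <= X -> taxi (d 0 x) <= M) ->
  exists2 C, 0 <= C & forall n x, 0 <= x <= X ->
    taxi (d n x) <= C / 2 ^+ n /\ taxi (d' n.+1 x) <= C / 2 ^+ n.
Proof.
move=> X0 Wi dP d'P d0 M0 Mb.
pose Q t := taxi (W t).
have Q0 t : 0 <= Q t by exact: taxi_ge0.
have Qi : seg_integrable X Q by exact: taxi_integrable.
pose q := seg_integral Q X.
have q0 : 0 <= q by apply: seg_integral_ge0 => t _.
(* The integration against W costs a factor q and the second integration gains 1/k, so this k makes
   the product at most 1/2; the 1 keeps k positive. *)
pose k := 2 * q + 1.
have k0 : 0 < k by rewrite /k; lra.
have step n D : 0 <= D -> (forall x, 0 <= x <= X -> taxi (d n x) <= D * expR (k * x)) ->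
    (forall x, 0 <= x <= X -> taxi (d' n.+1 x) <= D * q * expR (k * x)) /\
    (forall x, 0 <= x <= X -> taxi (d n.+1 x) <= D / 2 * expR (k * x)).
  move=> D0 Db; have [dn0 d'n0] := d0 n.
  have b1 x : 0 <= x <= X -> taxi (d' n.+1 x) <= D * q * expR (k * x).
    move=> xX; have := cprimitive_exp_bound k0 (lexx 0) D0 Q0 Qi (d'P n) d'n0.
    rewrite mul0r addr0; apply => // t tX; rewrite addr0.
    apply: le_trans (taxiM _ _) _; apply: ler_wpM2l; first exact: Q0.
    exact: Db.
  split=> // x xX.
  have := cprimitive_exp_bound k0 (ler01) (mulr_ge0 D0 q0) (fun _ => lexx 0)
    (seg_integrable_cst X 0) (dP n) dn0.
  move=> /(_ _ x xX); rewrite seg_integral_cst // mul0r add0r.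
  have h : D * q * (1 / k) <= D / 2.
    rewrite -mulrA ler_wpM2l // mul1r ler_pdivrMr // /k; lra.
  move=> H; apply: le_trans (H _) _.
    by move=> t tX; rewrite mul1r; exact: b1.
  by rewrite add0r ler_wpM2r ?expR_ge0.
have main n : forall x, 0 <= x <= X -> taxi (d n x) <= M / 2 ^+ n * expR (k * x).
  elim: n => [x xX|n IH].
    rewrite expr0 divr1 (le_trans (Mb x xX)) // ler_peMr //.
    by rewrite -[leLHS]expR0 ler_expR mulr_ge0 ?(ltW k0) //; have /andP[] := xX.
  have [|_] := step n (M / 2 ^+ n) _ IH; first by rewrite divr_ge0 // exprn_ge0.
  by rewrite exprSr invfM mulrA.
exists (M * (1 + q) * expR (k * X)).
  by rewrite !mulr_ge0 ?expR_ge0 // addr_ge0.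
move=> n x xX; have /andP[x0 xleX] := xX.
have Mn0 : 0 <= M / 2 ^+ n by rewrite divr_ge0 // exprn_ge0.
have ex : expR (k * x) <= expR (k * X) by rewrite ler_expR ler_wpM2l // ltW.
have eX : 0 <= expR (k * X) by exact: expR_ge0.
split.
  apply: le_trans (main n x xX) _.
  rewrite [leRHS](_ : _ = M / 2 ^+ n * ((1 + q) * expR (k * X))); last by ring.
  rewrite ler_wpM2l // (le_trans ex) //; nra.
have [b1 _] := step n (M / 2 ^+ n) Mn0 (main n).
apply: le_trans (b1 x xX) _.
rewrite [leRHS](_ : _ = M / 2 ^+ n * ((1 + q) * expR (k * X))); last by ring.
rewrite -mulrA ler_wpM2l // ler_pM ?expR_ge0 //; lra.
Qed.

Lemma geometric_small (C e : R) : 0 <= C -> 0 < e ->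
  exists N0, forall n, (N0 <= n)%N -> C / 2 ^+ n <= e.
Proof.
move=> C0 e0; exists (Num.trunc (C / e)).+1 => n nN.
rewrite ler_pdivrMr ?exprn_gt0 // mulrC -ler_pdivrMr //.
have /andP[_ /ltW] := trunc_itv (divr_ge0 C0 (ltW e0)).
move/le_trans; apply; rewrite -natrX ler_nat.
by rewrite (leq_trans nN) // ltnW // ltn_expl.
Qed.

(** A solution with zero initial data is a fixed point of the iteration, so the contraction applied
    to a constant sequence bounds it by C / 2^n for every n. *)
Lemma volterra_unique X (W : R -> R[i]) F f : 0 <= X -> cseg_integrable X W ->
  cprimitive_on X F f -> cprimitive_on X f (fun t => W t * F t) ->
  F 0 = 0 -> f 0 = 0 -> forall x, 0 <= x <= X -> F x = 0.
Proof.
move=> X0 Wi FP fP F0 f0 x xX.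
have [M M0 Mb] := cprimitive_on_bounded FP.
have [C C0 H] := @volterra_contraction X W (fun=> F) (fun=> f) M X0 Wi
   (fun=> FP) (fun=> fP) (fun=> conj F0 f0) M0 Mb.
apply: taxi_eq0; apply/le_anti; rewrite taxi_ge0 andbT.
apply/ler_addgt0Pl => e e0; rewrite addr0.
have [N HN] := geometric_small C0 e0.
by have [h _] := H N x xX; rewrite (le_trans h) // HN.
Qed.

End Volterra.

(** * Picard iterates as polynomials in the spectral parameter, their majorants and convergence *)

Section Picard.
Variable R : realType.
Local Notation Re := (@complex.Re R).
Local Notation Im := (@complex.Im R).
Implicit Types (x t X k : R) (z w lam : R[i]) (F G f g V : R -> R[i]).

Lemma seg_integral_sum X (n : nat) (h : nat -> R -> R) :
  (forall j, seg_integrable X (h j)) ->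
  seg_integrable X (fun t => \sum_(j < n) h j t) /\
  seg_integral (fun t => \sum_(j < n) h j t) X = \sum_(j < n) seg_integral (h j) X.
Proof.
move=> hi; elim: n => [|n [IHi IH]].
  rewrite big_ord0 (_ : (fun _ => _) = fun=> 0); last first.
    by apply: boolp.funext => t; rewrite big_ord0.
  split; first exact: seg_integrable_cst.
  by rewrite /seg_integral /Rintegral integral0.
rewrite (_ : (fun _ => _) = fun t => \sum_(j < n) h j t + h n t); last first.
  by apply: boolp.funext => t; rewrite big_ord_recr.
split; first exact: seg_integrableD.
by rewrite (seg_integralD IHi (hi n)) IH big_ord_recr.
Qed.

Lemma cprimitive_sum_bound X n (F f : nat -> R -> R[i]) (c : nat -> R) (b : R -> R) x :
  (forall j, cprimitive_on X (F j) (f j)) -> (forall j, 0 <= c j) ->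
  0 <= x <= X -> seg_integrable x b ->
  (forall t, 0 <= t <= x -> \sum_(j < n) c j * taxi (f j t) <= b t) ->
  \sum_(j < n) c j * taxi (F j x - F j 0) <= seg_integral b x.
Proof.
move=> FP c0 xX bi fb; have /andP[x0 xleX] := xX.
have fi j : seg_integrable x (fun t => taxi (f j t)).
  exact: taxi_integrable (cprimitive_on_integrable (cprimitive_on_sub xleX (FP j))).
have [si sE] := @seg_integral_sum x n (fun j t => c j * taxi (f j t))
  (fun j => seg_integrableZ (c j) (fi j)).
apply: (@le_trans _ _ (\sum_(j < n) seg_integral (fun t => c j * taxi (f j t)) x)).
  apply: ler_sum => j _; rewrite (seg_integralZ _ (fi j)) ler_wpM2l //.
  exact: (cprimitive_bound (FP j) xX).
by rewrite -sE; exact: le_seg_integral.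
Qed.

(* The n-th Picard iterate for -y'' + V y = lam y, y(0) = 0, y'(0) = 1 is a
   polynomial in lam; [picard V n] holds the coefficients of y and of y'. *)
Fixpoint picard V n : (nat -> R -> R[i]) * (nat -> R -> R[i]) :=
  if n is n'.+1 then
    let a := (picard V n').1 in
    let b j x := (j == 0)%N%:R + cseg_integral
      (fun t => V t * a j t - (if j is j'.+1 then a j' t else 0)) x in
    (fun j => cseg_integral (b j), b)
  else (fun _ _ => 0, fun _ _ => 0).

Definition pcoef V n j x := (picard V n).1 j x.
Definition pcoef' V n j x := (picard V n).2 j x.

Section Potential.
Variables (X : R) (V : R -> R[i]).
Hypotheses (X0 : 0 <= X) (Vi : cseg_integrable X V).

(** Coefficient of lam^j in (V - lam) times the n-th iterate; the shifted index comes from the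
    multiplication by lam. *)
Definition psource n j t : R[i] :=
  V t * pcoef V n j t - (if j is j'.+1 then pcoef V n j' t else 0).

Lemma picard_primitive n j :
  cprimitive_on X (pcoef' V n.+1 j) (psource n j) /\
  cprimitive_on X (pcoef V n.+1 j) (pcoef' V n.+1 j).
Proof.
have main m : (forall j, exists f, cprimitive_on X (pcoef V m j) f) ->
   forall j, cprimitive_on X (pcoef' V m.+1 j) (psource m j) /\
     cprimitive_on X (pcoef V m.+1 j) (pcoef' V m.+1 j).
  move=> aP i.
  have si : cseg_integrable X (psource m i).
    have [f fP] := aP i.
    have i1 := cseg_integrableM X0 fP Vi.
    have [g gP] : exists g, cprimitive_on X
        (fun t => if i is i'.+1 then pcoef V m i' t else 0) g.
      by case: i {f fP i1} => [|i]; [exists (fun=> 0); exact: cprimitive_on_cst|exact: aP].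
    have i2 := cseg_integrableM X0 (cprimitive_on_cst X (-1)) (cprimitive_cseg_integrable X0 gP).
    have := cseg_integrableD i1 i2; rewrite /psource.
    rewrite (_ : (fun t => _ + _) = fun t => V t * pcoef V m i t -
      (if i is i'.+1 then pcoef V m i' t else 0)) //.
    by apply: boolp.funext => t; rewrite mulN1r mulrC.
  have bP : cprimitive_on X (pcoef' V m.+1 i) (psource m i).
    exact: cprimitive_on_integral.
  split=> //.
  have := cprimitive_on_integral 0 (cprimitive_cseg_integrable X0 bP).
  by apply: cprimitive_on_ext => t _ //; rewrite add0r.
elim: n j => [|n IH]; apply: main => j.
  by exists (fun=> 0); exact: cprimitive_on_cst.
by exists (pcoef' V n.+1 j); case: (IH j).
Qed.

Lemma pcoef_at0 n j : pcoef V n j 0 = 0.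
Proof. by case: n => // n; rewrite /pcoef /= cseg_integral0. Qed.

Lemma pcoef'_at0 n j : pcoef' V n.+1 j 0 = (j == 0)%N%:R.
Proof. by rewrite /pcoef' /= cseg_integral0 addr0. Qed.

(** The iteration starts from 0 and each step multiplies by lam at most once, so the n-th iterate
    has degree below n and sums over j < n are complete. *)
Lemma pcoef_high n j : (n <= j)%N -> forall x, 0 <= x <= X ->
  pcoef V n j x = 0 /\ pcoef' V n j x = 0.
Proof.
elim: n j => [//|n IH] [//|j] nj x xX.
have [bP aP] := picard_primitive n j.+1.
have b0 y : 0 <= y <= X -> pcoef' V n.+1 j.+1 y = 0.
  move=> yX; rewrite (cprimitive_on0 bP _ yX) ?pcoef'_at0 // => t tX.
  rewrite /psource; have [-> _] := IH j.+1 (ltnW nj) t tX; have [-> _] := IH j nj t tX.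
  by rewrite mulr0 subr0.
by rewrite b0 // (cprimitive_on0 aP _ xX) ?pcoef_at0.
Qed.

(** Summing the recursion of the coefficients with weights s^j gives a scalar Volterra inequality
    with potential |V| + s. The function e^(kx) is a supersolution once 1 + |Q|_1 + (c + s) / k <=
    k, where the 1 is the initial slope. For large s the admissible k is about the square root of
    s. *)
Lemma picard_majorant (Q : R -> R) (c k s : R) :
  (forall t, 0 <= Q t) -> seg_integrable X Q -> 0 <= c -> 0 <= s -> 0 < k ->
  (forall t, 0 <= t <= X -> taxi (V t) <= Q t + c) ->
  1 + seg_integral Q X + (c + s) / k <= k ->
  forall n x, 0 <= x <= X ->
  \sum_(j < n) s ^+ j * taxi (pcoef V n j x) <= expR (k * x) /\
  \sum_(j < n) s ^+ j * taxi (pcoef' V n j x) <= k * expR (k * x).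
Proof.
move=> Q0 Qi c0 s0 k0 VQ kbig; elim=> [|n IH] x xX; have /andP[x0 xleX] := xX.
  by rewrite !big_ord0 mulr_ge0 ?expR_ge0 // ltW.
have E0 t : 0 <= expR (k * t) by exact: expR_ge0.
have source t : 0 <= t <= X -> \sum_(j < n.+1) s ^+ j * taxi (psource n j t) <=
    (Q t + (c + s)) * expR (k * t).
  move=> tX; have [an _] := IH t tX.
  have h1 : \sum_(j < n.+1) s ^+ j * taxi (V t * pcoef V n j t) <= (Q t + c) * expR (k * t).
    rewrite big_ord_recr /= (_ : pcoef V n n t = 0); last first.
      by case: (pcoef_high (leqnn n) tX).
    rewrite mulr0 taxi0 mulr0 addr0.
    apply: (@le_trans _ _ ((Q t + c) * \sum_(j < n) s ^+ j * taxi (pcoef V n j t))).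
      rewrite mulr_sumr ler_sum // => j _; rewrite mulrCA ler_wpM2l ?exprn_ge0 //.
      apply: le_trans (taxiM _ _) _; apply: ler_wpM2r; first exact: taxi_ge0.
      exact: VQ.
    by rewrite ler_wpM2l // addr_ge0.
  have h2 : \sum_(j < n.+1) s ^+ j *
      taxi (if nat_of_ord j is j'.+1 then pcoef V n j' t else 0) <= s * expR (k * t).
    rewrite big_ord_recl /= taxi0 mulr0 add0r.
    apply: (@le_trans _ _ (s * \sum_(j < n) s ^+ j * taxi (pcoef V n j t))).
      by rewrite mulr_sumr ler_sum // => j _; rewrite /= exprS mulrA.
    by rewrite ler_wpM2l.
  have := lerD h1 h2; rewrite -big_split /= -mulrDl -addrA.
  apply: le_trans; apply: ler_sum => j _.
  by rewrite -mulrDr ler_wpM2l ?exprn_ge0 // /psource taxiB.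
have bb y : 0 <= y <= X ->
    \sum_(j < n.+1) s ^+ j * taxi (pcoef' V n.+1 j y) <= k * expR (k * y).
  move=> yX; have /andP[y0 yleX] := yX.
  have Qiy := seg_integrable_sub yleX Qi.
  have cs0 : 0 <= c + s by rewrite addr_ge0.
  have bi : seg_integrable y (fun t => (Q t + (c + s)) * expR (k * t)).
    by apply: exp_integrable => //; apply: seg_integrableD Qiy (seg_integrable_cst _ _).
  have H := @cprimitive_sum_bound X n.+1 (pcoef' V n.+1) (psource n) (fun j => s ^+ j) _ y
    (fun j => (picard_primitive n j).1) (fun j => exprn_ge0 j s0) yX bi.
  have {}H : \sum_(j < n.+1) s ^+ j * taxi (pcoef' V n.+1 j y - pcoef' V n.+1 j 0) <=
      (seg_integral Q X + (c + s) / k) * expR (k * y).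
    apply: le_trans (H _) _.
      by move=> t /andP[t0 ty]; apply: source; rewrite t0 (le_trans ty).
    apply: le_trans (exp_integral_le y0 k0 cs0 Q0 Qiy) _.
    rewrite ler_wpM2r // lerD2r; exact: le_seg_integral_sub.
  have one : \sum_(j < n.+1) s ^+ j * taxi (pcoef' V n.+1 j 0) = 1.
    rewrite big_ord_recl /= pcoef'_at0 eqxx expr0 mul1r big1 => [|j _].
      by rewrite addr0 /taxi /= normr1 normr0 addr0.
    by rewrite pcoef'_at0 /= taxi0 mulr0.
  have : \sum_(j < n.+1) s ^+ j * taxi (pcoef' V n.+1 j y) <=
      (seg_integral Q X + (c + s) / k) * expR (k * y) + 1.
    rewrite -one; apply: le_trans (lerD H (lexx _)).
    rewrite -big_split /=; apply: ler_sum => j _; rewrite -mulrDr ler_wpM2l ?exprn_ge0 //.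
    by rewrite -{1}[pcoef' V n.+1 j y](subrK (pcoef' V n.+1 j 0)) taxiD.
  move=> /le_trans; apply.
  have e1 : 1 <= expR (k * y) by rewrite -[leLHS]expR0 ler_expR mulr_ge0 // ltW.
  apply: le_trans (ler_wpM2r (E0 y) kbig).
  rewrite [leRHS](_ : _ = (seg_integral Q X + (c + s) / k) * expR (k * y) + expR (k * y)).
    by rewrite lerD2l.
  by ring.
split; last exact: bb.
have kEi := (primitive_on_expR k x0).1.
have H := @cprimitive_sum_bound X n.+1 (pcoef V n.+1) (pcoef' V n.+1) (fun j => s ^+ j) _ x
    (fun j => (picard_primitive n j).2) (fun j => exprn_ge0 j s0) xX kEi.
have -> : \sum_(j < n.+1) s ^+ j * taxi (pcoef V n.+1 j x) =
    \sum_(j < n.+1) s ^+ j * taxi (pcoef V n.+1 j x - pcoef V n.+1 j 0).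
  by apply: eq_bigr => j _; rewrite pcoef_at0 subr0.
apply: le_trans (H _) _.
  by move=> t /andP[t0 tx]; apply: bb; rewrite t0 (le_trans tx).
have [_ kE] := primitive_on_expR k x0.
have := kE x; rewrite x0 lexx mulr0 expR0 => /(_ isT) ->; lra.
Qed.

Definition psol n lam x := \sum_(j < n) lam ^+ j * pcoef V n j x.
Definition psol' n lam x := \sum_(j < n) lam ^+ j * pcoef' V n j x.

Lemma psol_primitive n lam :
  cprimitive_on X (psol n.+1 lam) (psol' n.+1 lam) /\
  cprimitive_on X (psol' n.+1 lam) (fun t => (V t - lam) * psol n lam t).
Proof.
split.
  rewrite /psol /psol'.
  have := cprimitive_on_sum (index_enum 'I_n.+1) (fun j : 'I_n.+1 =>
    cprimitive_onZ (lam ^+ j) X0 (picard_primitive n j).2).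
  by apply: cprimitive_on_ext.
have := cprimitive_on_sum (index_enum 'I_n.+1) (fun j : 'I_n.+1 =>
    cprimitive_onZ (lam ^+ j) X0 (picard_primitive n j).1).
apply: cprimitive_on_ext => // t tX.
rewrite mulrBl /psol !mulr_sumr.
transitivity (\sum_(j < n.+1) lam ^+ j * (V t * pcoef V n j t) -
   \sum_(j < n.+1) lam ^+ j * (if nat_of_ord j is j'.+1 then pcoef V n j' t else 0)).
  by rewrite -sumrB; apply: eq_bigr => j _; rewrite -mulrBr.
congr (_ - _).
  rewrite big_ord_recr /= (_ : pcoef V n n t = 0); last by case: (pcoef_high (leqnn n) tX).
  by rewrite !mulr0 addr0; apply: eq_bigr => j _; rewrite mulrCA.
rewrite big_ord_recl /= mulr0 add0r; apply: eq_bigr => j _.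
by rewrite exprS mulrA.
Qed.

Lemma psol_at0 n lam : psol n lam 0 = 0.
Proof. by rewrite /psol big1 // => j _; rewrite pcoef_at0 mulr0. Qed.

Lemma psol'_at0 n lam : psol' n.+1 lam 0 = 1.
Proof.
rewrite /psol' big_ord_recl pcoef'_at0 eqxx expr0 mul1r big1 ?addr0 // => j _.
by rewrite pcoef'_at0 mulr0.
Qed.

Lemma cseg_integrableBc lam : cseg_integrable X (fun t => V t - lam).
Proof. exact: cseg_integrableD Vi (cseg_integrable_cst X (- lam)). Qed.

(** The difference between the solution and its iterates has zero initial data and is itself a
    sequence of iterated integrals, so the contraction applies to it. *)
Lemma psol_cvg lam F f (e : R) :
  cprimitive_on X F f -> cprimitive_on X f (fun t => (V t - lam) * F t) ->
  F 0 = 0 -> f 0 = 1 -> 0 < e ->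
  exists N, forall n, (N <= n)%N ->
    taxi (F X - psol n lam X) <= e /\ taxi (f X - psol' n lam X) <= e.
Proof.
move=> FP fP F0 f0 e0.
have [M M0 Mb] := cprimitive_on_bounded FP.
have [||||C C0 HC] := @volterra_contraction R X (fun t => V t - lam)
  (fun n x => F x - psol n lam x) (fun n x => f x - psol' n lam x) M X0 (cseg_integrableBc lam) _ _ _ M0.
- by move=> n; apply: cprimitive_onB => //; case: (psol_primitive n lam).
- move=> n; have := cprimitive_onB X0 fP (psol_primitive n lam).2.
  by apply: cprimitive_on_ext => t _ //; rewrite mulrBr.
- by move=> n; rewrite F0 f0 psol_at0 psol'_at0 !subrr.
- by move=> x xX; rewrite /psol big_ord0 subr0; exact: Mb.
have [N HN] := geometric_small C0 e0.
(* The shift by one is due to the derivative: that of iterate n + 1 is controlled by iterate n. *)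
exists N.+1 => -[//|n] nN; have XX : 0 <= X <= X by rewrite X0 lexx.
have [h _] := HC n.+1 X XX; have [_ h'] := HC n X XX.
by rewrite (le_trans h) ?HN ?(leq_trans (leqnSn _) nN) // (le_trans h') ?HN.
Qed.

(** Where no eigenfunction is at hand, iterate n + 1 serves as an approximate solution, and its
    distance to iterate n measures the defect. *)
Lemma psol_cauchy lam (e : R) : 0 < e ->
  exists N, forall n, (N <= n)%N -> forall x, 0 <= x <= X ->
    taxi (psol n lam x - psol n.+1 lam x) <= e.
Proof.
move=> e0; have [p1 _] := psol_primitive 0 lam.
have [M M0 Mb] := cprimitive_on_bounded p1.
have [||||C C0 HC] := @volterra_contraction R X (fun t => V t - lam)
  (fun n x => psol n lam x - psol n.+1 lam x)
  (fun n x => psol' n lam x - psol' n.+1 lam x) M X0 (cseg_integrableBc lam) _ _ _ M0.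
- move=> n; apply: cprimitive_onB => //; first by case: (psol_primitive n lam).
  by case: (psol_primitive n.+1 lam).
- move=> n; have := cprimitive_onB X0 (psol_primitive n lam).2 (psol_primitive n.+1 lam).2.
  by apply: cprimitive_on_ext => t _ //; rewrite mulrBr.
- by move=> n; rewrite !psol_at0 !psol'_at0 !subrr.
- by move=> x xX; rewrite {1}/psol big_ord0 sub0r taxiN; exact: Mb.
have [N HN] := geometric_small C0 e0.
by exists N => n nN x xX; have [h _] := HC n x xX; rewrite (le_trans h) ?HN.
Qed.

End Potential.
End Picard.

(** * Large energies *)

Section LargeEnergy.
Variable R : realType.
Local Notation Re := (@complex.Re R).
Local Notation Im := (@complex.Im R).
Variables (r Q eta eps : R) (q h F f : R -> R[i]) (w : R[i]).

Let nq := seg_integral (fun t => taxi (q t)) r.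
Let G t := taxi (q t) + taxi (w ^+ 2).

Hypotheses (r0 : 0 <= r) (qi : cseg_integrable r q).
Hypotheses (eta0 : 0 <= eta) (Imw : - eta <= Im w).
Hypotheses (qQ : forall t, Q < t -> q t = 0) (etaQ : expR (2 * eta * Q) <= 2).
Hypotheses (w0 : 0 < cmod w) (wq : 40 * nq <= cmod w).
Hypotheses (FP : cprimitive_on r F f).
Hypotheses (fP : cprimitive_on r f (fun t => (q t - w ^+ 2) * h t)).
Hypotheses (F0 : F 0 = 0) (f0 : f 0 = 1).
Hypotheses (eps0 : 0 <= eps).
Hypotheses (Fh : forall t, 0 <= t <= r -> taxi (h t - F t) <= eps).
Hypotheses (epsG : 32 * expR (eta * r) * eps * seg_integral G r <= 1).

Let expR_ge0' (x : R) : 0 <= expR x := expR_ge0 x.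

Let Qi : seg_integrable r (fun t => taxi (q t)).
Proof. exact: taxi_integrable. Qed.

Let Gi : seg_integrable r G.
Proof. exact: seg_integrableD Qi (seg_integrable_cst _ _). Qed.

Let nq0 : 0 <= nq.
Proof. by apply: seg_integral_ge0 => t _; exact: taxi_ge0. Qed.

(* F solves the equation with potential applied to h instead of F: h = F for a
   solution, h is the previous iterate when F is a Picard iterate. *)
Let err t := (q t - w ^+ 2) * (h t - F t).

(** The factor e^(iux) is integrating: (y' - iuy) e^(iux) has derivative (y'' + u^2 y) e^(iux), and
    y'' + w^2 y is q y plus [err]. It is used for both signs u = w and u = -w. *)
Lemma variation_of_constants u : u ^+ 2 = w ^+ 2 ->
  cprimitive_on r (fun t => (f t - 'i * u * F t) * cexp u t)
    (fun t => cexp u t * (q t * F t + err t)).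
Proof.
move=> uw.
have := cprimitive_onM r0 (cprimitive_onB r0 fP (cprimitive_onZ ('i * u) r0 FP))
  (cprimitive_on_cexp u r0).
apply: cprimitive_on_ext => // t _; rewrite /err -uw.
have ii : 'i * 'i = -1 :> R[i] by rewrite -expr2 sqr_i.
rewrite [LHS](_ : _ = cexp u t * (q t * F t + (q t - u ^+ 2) * (h t - F t))
   - ('i * 'i + 1) * (u ^+ 2 * F t * cexp u t)); last by ring.
by rewrite ii addNr mul0r subr0.
Qed.

(* U and V are y' - iwy and y' + iwy, each divided by its free evolution, and
   2iw E = e^(2iwx) V - U.  The source terms of U and V involve only q E, which
   gains a factor 1/|w|: hence U stays close to 1. *)
Let E t := cexp w t * F t.

Let cexp_le t : 0 <= t <= r -> taxi (cexp w t) <= 2 * expR (eta * r).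
Proof.
move=> /andP[t0 tr]; apply: le_trans (taxi_cmod _) _.
rewrite ler_wpM2l // cmod_cexp ler_expR.
have : - eta * t <= Im w * t by rewrite ler_wpM2r.
have : eta * t <= eta * r by rewrite ler_wpM2l.
lra.
Qed.

Let eg_le t : 0 <= t <= r -> taxi (cexp w t * err t) <= 2 * expR (eta * r) * eps * G t.
Proof.
move=> tr; apply: le_trans (taxiM _ _) _.
rewrite -mulrA; apply: ler_pM; [exact: taxi_ge0|exact: taxi_ge0|exact: cexp_le|].
rewrite mulrC; apply: le_trans (taxiM _ _) _.
apply: ler_pM; [exact: taxi_ge0|exact: taxi_ge0|exact: taxiB|exact: Fh].
Qed.

(** [c2 * G t] bounds the defect e^(iwt) [err t], and the constant 32 in [epsG] makes its integral
    at most 1/16. *)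
Let c2 := 2 * expR (eta * r) * eps.

Let c20 : 0 <= c2. Proof. by rewrite /c2 !mulr_ge0. Qed.

Let c2G x : 0 <= x <= r -> c2 * seg_integral G x <= 1 / 16.
Proof.
move=> xr; have G0 t : 0 <= G t by rewrite addr_ge0 ?taxi_ge0.
have h1 := le_seg_integral_sub xr Gi (fun t _ => G0 t).
have : c2 * seg_integral G x <= c2 * seg_integral G r by rewrite ler_wpM2l.
have := epsG; rewrite /c2; lra.
Qed.

Let U t := (f t - 'i * w * F t) * cexp w t.
Let V t := (f t - 'i * (- w) * F t) * cexp (- w) t.

Let U0 : U 0 = 1.
Proof. by rewrite /U F0 f0 mulr0 subr0 cexp0 mulr1. Qed.

Let V0 : V 0 = 1.
Proof. by rewrite /V F0 f0 mulr0 subr0 cexp0 mulr1. Qed.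

Section Bootstrap.
Variable D : R.
Hypotheses (D0 : 0 <= D) (ED : forall t, 0 <= t <= r -> taxi (E t) <= D * expR (2 * eta * t)).

Let bound_int (c : R) x : 0 <= c -> 0 <= x <= r ->
  seg_integrable x (fun t => c * (D * taxi (q t) + c2 * G t)) /\
  seg_integral (fun t => c * (D * taxi (q t) + c2 * G t)) x <= c * (D * nq + 1 / 16).
Proof.
move=> cge0 xr; have /andP[x0 xler] := xr.
have Qix := seg_integrable_sub xler Qi; have Gix := seg_integrable_sub xler Gi.
have S := seg_integrableD (seg_integrableZ D Qix) (seg_integrableZ c2 Gix).
split; first exact: seg_integrableZ.
rewrite (seg_integralZ _ S) ler_wpM2l //.
rewrite (seg_integralD (seg_integrableZ D Qix) (seg_integrableZ c2 Gix)).
rewrite (seg_integralZ _ Qix) (seg_integralZ _ Gix) lerD ?c2G //.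
rewrite ler_wpM2l //; apply: le_seg_integral_sub => // t _; exact: taxi_ge0.
Qed.

Let source_le t : 0 <= t <= r -> taxi (cexp w t * (q t * F t + err t)) <=
  D * taxi (q t) * expR (2 * eta * t) + c2 * G t.
Proof.
move=> tr; rewrite mulrDr; apply: le_trans (taxiD _ _) _.
apply: lerD; last exact: eg_le.
rewrite [leRHS](_ : _ = taxi (q t) * (D * expR (2 * eta * t))); last by ring.
rewrite [X in taxi X](_ : _ = q t * E t); last by rewrite mulrCA.
apply: le_trans (taxiM _ _) _.
by apply: ler_wpM2l; [exact: taxi_ge0|exact: ED].
Qed.

Lemma U_close x : 0 <= x <= r -> taxi (U x - 1) <= (D * nq + 1 / 16) * expR (2 * eta * x).
Proof.
move=> xr; have /andP[x0 xler] := xr.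
have [bi bE] := bound_int (expR_ge0' (2 * eta * x)) xr.
rewrite -U0 mulrC; apply: le_trans _ bE.
apply: (cprimitive_bound (variation_of_constants (erefl _)) xr bi) => t /andP[t0 tx].
have tr : 0 <= t <= r by rewrite t0 (le_trans tx).
apply: le_trans (source_le tr) _.
have ett : expR (2 * eta * t) <= expR (2 * eta * x).
  by rewrite ler_expR ler_wpM2l // mulr_ge0.
have e1 : 1 <= expR (2 * eta * x) by rewrite -[leLHS]expR0 ler_expR !mulr_ge0.
rewrite /= [leRHS]mulrDr lerD //.
  by rewrite mulrC ler_wpM2r // mulr_ge0 ?taxi_ge0.
by rewrite ler_peMl // mulr_ge0 // addr_ge0 ?taxi_ge0.
Qed.

(** The growth e^(2 eta t) of the bound on E matters only where q lives, that is for t <= Q, and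
    costs at most a factor 2 there. So U stays near 1 at the far end of the barrier without a loss
    e^(2 eta r). *)
Lemma U_close_end : taxi (U r - 1) <= 2 * D * nq + 1 / 16.
Proof.
have rr : 0 <= r <= r by rewrite r0 lexx.
have S := seg_integrableD (seg_integrableZ (2 * D) Qi) (seg_integrableZ c2 Gi).
rewrite -U0; apply: (@le_trans _ _ (seg_integral (fun t => 2 * D * taxi (q t) + c2 * G t) r)).
  apply: (cprimitive_bound (variation_of_constants (erefl _)) rr S) => t tr.
  apply: le_trans (source_le tr) _; rewrite lerD2r.
  rewrite [leRHS](_ : _ = D * taxi (q t) * 2); last by ring.
  case: (leP t Q) => tQ; last by rewrite qQ // taxi0 mulr0 !mul0r.
  rewrite ler_wpM2l ?mulr_ge0 ?taxi_ge0 // (le_trans _ etaQ) // ler_expR.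
  by rewrite ler_wpM2l // mulr_ge0.
rewrite (seg_integralD (seg_integrableZ _ Qi) (seg_integrableZ _ Gi)).
by rewrite (seg_integralZ _ Qi) (seg_integralZ _ Gi) lerD2l c2G.
Qed.

Lemma V_le x : 0 <= x <= r ->
  taxi (cexp (w + w) x * V x) <= (2 + 2 * (D * nq + 1 / 16)) * expR (2 * eta * x).
Proof.
move=> xr; have /andP[x0 xler] := xr.
pose b := expR (2 * eta * x); have b0 : 0 <= 2 * b by rewrite mulr_ge0 ?expR_ge0.
have w2x : taxi (cexp (w + w) x) <= 2 * b.
  apply: le_trans (taxi_cmod _) _; rewrite ler_wpM2l // cmod_cexp ler_expR.
  have : - eta * x <= Im w * x by rewrite ler_wpM2r.
  by rewrite raddfD /=; lra.
have [bi bE] := bound_int b0 xr.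
have VP : cprimitive_on r V (fun t => cexp (- w) t * (q t * F t + err t)).
  by apply: variation_of_constants; rewrite sqrrN.
have VP' := cprimitive_onZ (cexp (w + w) x) r0 VP.
have key : taxi (cexp (w + w) x * V x - cexp (w + w) x * V 0) <= 2 * b * (D * nq + 1 / 16).
  apply: le_trans _ bE.
  apply: (cprimitive_bound VP' xr bi) => t /andP[t0 tx].
  have tr : 0 <= t <= r by rewrite t0 (le_trans tx).
  (* The phase is regrouped as e^(2iw(x-t)) e^(iwt). Since x - t >= 0, its first factor is at most
     e^(2 eta (x-t)), which completes the weight e^(2 eta t) of the source to e^(2 eta x). *)
  have -> : cexp (w + w) x * (cexp (- w) t * (q t * F t + err t)) =
     (cexp (w + w) x * cexp (- (w + w)) t) * (cexp w t * (q t * F t + err t)).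
    have -> : cexp (- w) t = cexp (- (w + w)) t * cexp w t.
      by rewrite -(cexpD (- (w + w)) w t) (_ : - (w + w) + w = - w) //; ring.
    by ring.
  apply: le_trans (taxiM _ _) _.
  have ph : taxi (cexp (w + w) x * cexp (- (w + w)) t) <= 2 * b * expR (- (2 * eta * t)).
    apply: le_trans (taxi_cmod _) _; rewrite -mulrA ler_wpM2l // cmodM !cmod_cexp.
    rewrite -expRD -[leRHS]expRD ler_expR !raddfN raddfD /=.
    have : - eta * (x - t) <= Im w * (x - t) by rewrite ler_wpM2r // subr_ge0.
    by lra.
  apply: le_trans (ler_pM (taxi_ge0 _) (taxi_ge0 _) ph (source_le tr)) _.
  rewrite -(mulrA (2 * b)) ler_wpM2l // mulrDr lerD //.
    by rewrite mulrCA -expRD addNr expR0 mulr1.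
  rewrite ler_piMl ?mulr_ge0 //; first by rewrite addr_ge0 ?taxi_ge0.
  by rewrite -[leRHS]expR0 ler_expR oppr_le0 !mulr_ge0.
have := taxiD (cexp (w + w) x * V x - cexp (w + w) x * V 0) (cexp (w + w) x * V 0).
rewrite subrK V0 mulr1 in key *; rewrite -/b; lra.
Qed.

(** In 2iwE = e^(2iwx) V - U the right-hand side is at most 4 + 3 D [nq] in the weight e^(2 eta t).
    After division by |w|, the assumption 40 [nq] <= |w| turns the part containing D into at most
    D/2. *)
Lemma bootstrap t : 0 <= t <= r -> taxi (E t) <= (4 / cmod w + D / 2) * expR (2 * eta * t).
Proof.
move=> tr; have /andP[t0 _] := tr.
have e1 : 1 <= expR (2 * eta * t) by rewrite -[leLHS]expR0 ler_expR !mulr_ge0.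
have EE : ('i * (w + w)) * E t = cexp (w + w) t * V t - U t.
  rewrite /V /U /E cexpD.
  rewrite [RHS](_ : _ = cexp w t * (cexp w t * cexp (- w) t) * (f t - 'i * (- w) * F t) -
    (f t - 'i * w * F t) * cexp w t); last by ring.
  by rewrite cexpNK; ring.
have h1 : taxi (('i * (w + w)) * E t) <= (4 + 3 * (D * nq)) * expR (2 * eta * t).
  rewrite EE; apply: le_trans (taxiB _ _) _.
  have := V_le tr; have := U_close tr; have := taxiD (U t - 1) 1.
  rewrite subrK (_ : taxi 1 = 1); last by rewrite /taxi /= normr1 normr0 addr0.
  set x := expR _ in e1 *; lra.
have h2 : taxi (E t) * cmod w <= (4 + 3 * (D * nq)) * expR (2 * eta * t).
  apply: le_trans _ h1; apply: le_trans _ (cmod_taxi _).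
  have -> : 'i * (w + w) * E t = 2%:C * ('i * (w * E t)).
    by rewrite rmorph_nat; ring.
  rewrite (cmodM 2%:C) cmod_real ger0_norm // (cmodM 'i) cmodi mul1r (cmodM w).
  rewrite [leRHS](_ : _ = (2 * cmod (E t)) * cmod w); last by ring.
  by apply: ler_wpM2r; [exact: cmod_ge0|exact: taxi_cmod].
rewrite -(ler_pM2r w0); apply: le_trans h2 _.
rewrite [leRHS](_ : _ = (4 + D / 2 * cmod w) * expR (2 * eta * t)); last first.
  by field; rewrite gt_eqF.
rewrite ler_wpM2r // lerD2l.
have : D * (40 * nq) <= D * cmod w by rewrite ler_wpM2l.
have : 0 <= D * nq by rewrite mulr_ge0.
lra.
Qed.

End Bootstrap.

(** Any a priori bound M starts the iteration of D |-> 4/|w| + D/2, whose fixed point is 8/|w|. *)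
Lemma E_le t : 0 <= t <= r -> taxi (E t) <= (8 / cmod w) * expR (2 * eta * t).
Proof.
have [M M0 Mb] := cprimitive_on_bounded
  (cprimitive_onM r0 (cprimitive_on_cexp w r0) FP).
have iter n : forall t, 0 <= t <= r ->
    taxi (E t) <= (8 / cmod w + M / 2 ^+ n) * expR (2 * eta * t).
  have w80 : 0 <= 8 / cmod w by rewrite divr_ge0 // ltW.
  elim: n => [|n IH] x xr; have /andP[x0 _] := xr.
    have e1 : 1 <= expR (2 * eta * x) by rewrite -[leLHS]expR0 ler_expR !mulr_ge0.
    apply: le_trans (Mb x xr) _; rewrite expr0 divr1.
    rewrite -[leLHS]mulr1 ler_pM //; lra.
  have := bootstrap _ IH xr; rewrite addr_ge0 // ?divr_ge0 ?exprn_ge0 // => /(_ isT).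
  move=> /le_trans; apply; rewrite ler_wpM2r // exprSr invfM; lra.
move=> tr; set x := expR _.
have x0 : 0 < x by exact: expR_gt0.
apply/ler_addgt0Pr => e e0.
have [n Hn] := geometric_small M0 (divr_gt0 e0 x0).
apply: le_trans (iter n t tr) _; rewrite -/x mulrDl lerD2l.
by rewrite -ler_pdivlMr // Hn.
Qed.

(** In the identity 2w (y' - izy) e^(iwr) = (z + w) U - (z - w) e^(2iwr) V the first term has
    modulus at least |z + w| / 2 because U is near 1; only the second one carries the amplification
    by the barrier. *)
Lemma large_energy_bound z :
  cmod (z + w) / 2 - 3 * cmod (z - w) * expR (2 * eta * r) <=
  2 * cmod w * cmod (f r - 'i * z * F r) * expR (- (Im w * r)).
Proof.
have rr : 0 <= r <= r by rewrite r0 lexx.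
have D0 : 0 <= 8 / cmod w by rewrite divr_ge0 // ltW.
(* With D = 8/|w| the assumption 40 [nq] <= |w| gives D [nq] <= 1/5, whence |U - 1| <= 2/5 + 1/16 <
   1/2. *)
have Dq : 8 / cmod w * nq <= 1 / 5.
  rewrite mulrAC ler_pdivrMr //; have := wq; lra.
have Ur := U_close_end D0 E_le; have Vr := V_le D0 E_le rr.
have id : (2%:C * w) * (f r - 'i * z * F r) * cexp w r =
    (z + w) * U r - (z - w) * (cexp (w + w) r * V r).
  rewrite /U /V cexpD (_ : 2%:C = 2); last by rewrite rmorph_nat.
  rewrite [RHS](_ : _ = (z + w) * ((f r - 'i * w * F r) * cexp w r) -
    (z - w) * ((cexp w r * cexp (- w) r) * cexp w r * (f r - 'i * - w * F r))); last by ring.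
  by rewrite cexpNK; ring.
have -> : 2 * cmod w * cmod (f r - 'i * z * F r) * expR (- (Im w * r)) =
    cmod ((2%:C * w) * (f r - 'i * z * F r) * cexp w r).
  by rewrite [in RHS]cmodM cmod_cexp cmodM (cmodM 2%:C) cmod_real ger0_norm.
rewrite id; apply: le_trans _ (cmodBr _ _); rewrite (cmodM (z + w)) (cmodM (z - w)).
have U2 : 1 / 2 <= cmod (U r).
  have := cmodBr 1 (1 - U r); rewrite cmod1 opprB addrCA subrr addr0.
  have := cmod_taxi (1 - U r); rewrite -opprB taxiN; lra.
have V3 : cmod (cexp (w + w) r * V r) <= 3 * expR (2 * eta * r).
  apply: le_trans (cmod_taxi _) _; apply: le_trans Vr _.
  rewrite ler_wpM2r //; lra.
apply: lerB.
  by rewrite ler_wpM2l ?cmod_ge0 // -[leLHS]mul1r.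
rewrite [leRHS](_ : _ = cmod (z - w) * (3 * expR (2 * eta * r))); last by ring.
by rewrite ler_wpM2l ?cmod_ge0.
Qed.

End LargeEnergy.

(** * The boundary condition satisfied by eigenfunctions *)

Section Eigenfunction.
Variable R : realType.
Local Notation mu := (@lebesgue_measure R).
Local Notation Re := (@complex.Re R).
Local Notation Im := (@complex.Im R).
Implicit Types (x t X : R) (lam z : R[i]).

Lemma seg_integral_truncl (f : R -> R) x s : 0 <= s <= x -> seg_integrable x f ->
  seg_integral (fun t => if s < t then f t else 0) x =
  seg_integral f x - seg_integral f s.
Proof.
move=> /andP[s0 sx] fi; rewrite /seg_integral !segE.
rewrite Rintegral_itvB; first last.
- by rewrite bnd_simp.
- by rewrite bnd_simp.
- by rewrite -segE.
rewrite [RHS]Rintegral_mkcond [LHS]Rintegral_mkcond; apply: eq_Rintegral => t _.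
rewrite /patch !mem_setE !in_itv /=.
case: (ltP s t) => st; case: (leP t x) => tx; rewrite ?andbF ?if_same //=.
by rewrite (le_trans s0 (ltW st)).
Qed.

Lemma seg_integral_eventually0 (f : R -> R) r x : 0 <= r <= x -> seg_integrable x f ->
  (forall t, r < t <= x -> f t = 0) -> seg_integral f x = seg_integral f r.
Proof.
move=> rx fi f0; apply/eqP; rewrite -subr_eq0 -(seg_integral_truncl rx fi).
rewrite (@seg_integral_ext _ _ (fun=> 0)); last first.
  move=> t; rewrite inE => /andP[_ tx]; case: ifP => // rt.
  by rewrite f0 ?rt.
by rewrite seg_integral_cst ?mul0r //; have /andP[] := rx; exact: le_trans.
Qed.

Lemma cprimitive_eventually_cst (F f : R -> R[i]) r x : 0 <= r <= x -> cprimitive_on x F f ->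
  (forall t, r < t <= x -> f t = 0) -> F x = F r.
Proof.
move=> rx [[fr FrE] [fim FiE]] f0; have /andP[r0 rlex] := rx.
have xx : 0 <= x <= x by rewrite lexx andbT (le_trans r0).
apply/eqP; rewrite eq_complex (FrE _ xx) (FiE _ xx) (FrE _ rx) (FiE _ rx).
rewrite (seg_integral_eventually0 rx fr) => [|t tx]; last by rewrite f0.
by rewrite (seg_integral_eventually0 rx fim) ?eqxx // => t tx; rewrite f0.
Qed.

(** By the equation y' is a primitive, hence continuous, hence y is a primitive of y'. Replacing V
    by V', equal to it almost everywhere, leaves the integrals unchanged. *)
Lemma eigen_primitives (V V' : R -> R[i]) lam :
  (forall X, 0 <= X -> cseg_integrable X V') ->
  {ae mu, forall t, 0 < t -> V t = V' t} ->
  is_eigenvalue V lam ->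
  exists y f, [/\ exists x, 0 <= x /\ y x != 0, y 0 = 0, csq_integrable (@halfline R) y &
    forall X, 0 <= X -> cprimitive_on X y f /\
      cprimitive_on X f (fun t => (V' t - lam) * y t)].
Proof.
move=> V'i VV' [y [yn0 y0 dy y2 Hy]].
pose W t := (V t - lam) * y t; pose W' t := (V' t - lam) * y t.
have fP X : 0 <= X -> cprimitive_on X (cderive y) W.
  move=> X0; have [[Wr Wi] _] := Hy X X0; split; split=> // x /andP[x0 _].
    have [_ /(congr1 Re)] := Hy x x0; rewrite raddfB /= => /eqP.
    by rewrite subr_eq addrC => /eqP.
  have [_ /(congr1 Im)] := Hy x x0; rewrite raddfB /= => /eqP.
  by rewrite subr_eq addrC => /eqP.
have yP X : 0 <= X -> cprimitive_on X y (cderive y).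
  move=> X0; have [Pr Pi] := fP X X0; split.
    apply: primitive_on_derivable => //; first by move=> x; case: (dy x).
    exact: primitive_on_continuous Pr.
  apply: primitive_on_derivable => //; first by move=> x; case: (dy x).
  exact: primitive_on_continuous Pi.
exists y, (cderive y); split=> // X X0; split; first exact: yP.
have W'i Z : 0 <= Z -> cseg_integrable Z W'.
  move=> Z0; have := cseg_integrableM Z0 (yP Z Z0)
    (cseg_integrableD (V'i Z Z0) (cseg_integrable_cst Z (- lam))).
  by rewrite /W'; under boolp.eq_fun do rewrite mulrC.
(* At t = 0, where V and V' are not compared, both sides vanish because y 0 = 0. *)
have WW' : {ae mu, forall t, 0 <= t -> W t = W' t}.
  move: VV'; apply: negligibleS => t /=; apply: contra_not => Vt.
  rewrite /W /W' le_eqVlt => /predU1P[<-|t0]; first by rewrite y0 !mulr0.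
  by rewrite Vt.
have eqI (p : R[i] -> R) x : 0 <= x -> seg_integrable x (fun t => p (W t)) ->
    seg_integrable x (fun t => p (W' t)) ->
    seg_integral (fun t => p (W t)) x = seg_integral (fun t => p (W' t)) x.
  move=> x0 i1 i2; rewrite /seg_integral /Rintegral; congr fine.
  apply: ae_eq_integral; first exact: measurable_seg.
  - exact: measurable_int i1.
  - exact: measurable_int i2.
  - move: WW'; apply: negligibleS => t /=; apply: contra_not => Wt /andP[t0 _].
    by rewrite Wt.
have [[i1 E1] [i2 E2]] := fP X X0; have [j1 j2] := W'i X X0.
split; split=> // x xX; have /andP[x0 xleX] := xX.
  by rewrite (E1 x xX) (eqI Re x x0) //; exact: seg_integrable_sub xleX _.
by rewrite (E2 x xX) (eqI Im x x0) //; exact: seg_integrable_sub xleX _.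
Qed.

Lemma sqrtc_upper lam : exists2 z : R[i], z ^+ 2 = lam & 0 <= Im z.
Proof.
have [h|h] := leP 0 (Im (sqrtc lam)); first by exists (sqrtc lam); rewrite ?sqr_sqrtc.
by exists (- sqrtc lam); rewrite ?sqrrN ?sqr_sqrtc // raddfN oppr_ge0 ltW.
Qed.

Lemma seg_integral_le_halfline (S : R -> R) : (forall t, 0 <= S t) ->
  mu.-integrable (@halfline R) (fun t => (S t)%:E) ->
  exists2 I, 0 <= I & forall X, 0 <= X -> seg_integrable X S /\ seg_integral S X <= I.
Proof.
move=> S0 Si; exists (\int[mu]_(t in @halfline R) S t); first exact: Rintegral_ge0.
have hE : @halfline R = `[0, +oo[%classic.
  by apply/seteqP; split => t; rewrite /halfline /= in_itv /= andbT.
rewrite hE in Si *.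
have sub X : seg X `<=` `[0, +oo[%classic.
  by move=> t /andP[t0 _]; rewrite /= in_itv /= t0.
move=> X X0; have SX : seg_integrable X S by exact: integrableS Si.
split=> //; apply: fine_le.
- exact: (integrable_fin_num (measurable_seg X) SX).
- exact: (integrable_fin_num _ Si).
- apply: ge0_subset_integral => //; first exact: measurable_int Si.
  by move=> t _; rewrite lee_fin.
Qed.

(* a (x - r) = [y e_z]_r^x - 2iz \int_r^x y e_z for the constant value a of
   (y' - i z y) e_z, so a <> 0 would force |y| to grow linearly. *)
Lemma eigen_outgoing (V : R -> R[i]) (r : R) z (y f : R -> R[i]) :
  0 <= r -> (forall t, r < t -> V t = 0) -> 0 <= Im z -> y 0 = 0 ->
  csq_integrable (@halfline R) y ->
  (forall X, 0 <= X -> cprimitive_on X y f /\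
     cprimitive_on X f (fun t => (V t - z ^+ 2) * y t)) ->
  f r = 'i * z * y r.
Proof.
move=> r0 V0 z0 y00 y2 yP.
pose A t := (f t - 'i * z * y t) * cexp z t.
have AP X : 0 <= X -> cprimitive_on X A (fun t => cexp z t * (V t * y t)).
  move=> X0; have [P1 P2] := yP X X0.
  have := variation_of_constants X0 P1 P2 (erefl (z ^+ 2)).
  by apply: cprimitive_on_ext => // t _; rewrite subrr mulr0 addr0.
pose a := A r.
have Aa X : r <= X -> A X = a.
  move=> rX; have X0 := le_trans r0 rX.
  apply: (cprimitive_eventually_cst _ (AP X X0)); first by rewrite r0.
  by move=> t /andP[rt _]; rewrite V0 // mul0r mulr0.
have [a0|an0] := eqVneq a 0.
  move/eqP: a0; rewrite /a /A mulf_eq0 => /orP[|/eqP e0].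
    by rewrite subr_eq0 => /eqP.
  by have := cexpNK z r; rewrite e0 mul0r => /esym /eqP; rewrite oner_eq0.
exfalso.
pose al := taxi a.
have al0 : 0 < al.
  rewrite lt_neqAle taxi_ge0 andbT eq_sym; apply: contraNneq an0 => al0.
  exact/eqP/taxi_eq0.
pose S t := Re (y t) ^+ 2 + Im (y t) ^+ 2.
have S0 t : 0 <= S t by rewrite addr_ge0 ?sqr_ge0.
have [I I0 SI] := seg_integral_le_halfline S0 y2.
pose K := 2 * taxi ('i * z * 2); have K0 : 0 <= K by rewrite mulr_ge0 ?taxi_ge0.
(* In |y| <= d + |y|^2 / (4d) the second term has a bounded integral, and the first contributes K d
   X. This d makes K d at most [al / 2], so half of the linear growth survives. *)
pose d := al / (2 * (K + 1)).
have d0 : 0 < d by rewrite divr_gt0 // mulr_gt0 // ltr_wpDl.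
have Kd : K * d <= al / 2.
  rewrite /d mulrCA ler_wpM2l ?(ltW al0) // invfM mulrCA ler_piMr ?invr_ge0 //.
  by rewrite ler_pdivrMr ?ltr_wpDl // mul1r lerDl.
have yS t : cmod (y t) <= d + S t / (4 * d).
  rewrite -subr_ge0 [X in 0 <= X](_ : _ = (cmod (y t) - 2 * d) ^+ 2 / (4 * d)).
    by apply: divr_ge0; [exact: sqr_ge0|apply: mulr_ge0 => //; exact: ltW].
  by rewrite /S -cmod_sqr; field; rewrite gt_eqF.
have ez t : 0 <= t -> cmod (cexp z t) <= 1.
  move=> t0; rewrite cmod_cexp -[leRHS]expR0 ler_expR oppr_le0.
  by rewrite mulr_ge0.
pose G t := y t * cexp z t - a * t%:C.
have idP X : 0 <= X -> cprimitive_on X (fun t => t%:C) (fun=> 1).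
  move=> X0; have := cprimitive_on_integral 0 (cseg_integrable_cst X 1).
  apply: cprimitive_on_ext => // t /andP[t0 _].
  by rewrite add0r /cseg_integral /= !seg_integral_cst // mul1r mul0r.
pose g t := (A t - a) + 'i * z * 2 * (y t * cexp z t).
have GP X : 0 <= X -> cprimitive_on X G g.
  move=> X0; have [P1 _] := yP X X0.
  have := cprimitive_onB X0 (cprimitive_onM X0 P1 (cprimitive_on_cexp z X0))
    (cprimitive_onZ a X0 (idP X X0)).
  by apply: cprimitive_on_ext => // t _; rewrite /g /A; ring.
have Ai X : 0 <= X -> seg_integrable X (fun t => taxi (A t - a)).
  move=> X0; apply: taxi_integrable; apply: cseg_integrableD (cseg_integrable_cst X (- a)).
  exact: cprimitive_cseg_integrable X0 (AP X X0).
pose C := seg_integral (fun t => taxi (A t - a)) r.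
have bound X : r <= X -> al * X <= 2 * cmod (y X) + (C + K * (d * X + I / (4 * d))).
  move=> rX; have X0 := le_trans r0 rX; have XX : 0 <= X <= X by rewrite X0 lexx.
  have [Si SIX] := SI X X0.
  pose b t := taxi (A t - a) + K * (d + (4 * d)^-1 * S t).
  have i1 := seg_integrableD (seg_integrable_cst X d) (seg_integrableZ (4 * d)^-1 Si).
  have bi : seg_integrable X b := seg_integrableD (Ai X X0) (seg_integrableZ K i1).
  have bE : seg_integral b X <= C + K * (d * X + I / (4 * d)).
    rewrite (seg_integralD (Ai X X0) (seg_integrableZ K i1)) (seg_integralZ _ i1).
    rewrite (seg_integralD (seg_integrable_cst X d) (seg_integrableZ (4 * d)^-1 Si)).
    rewrite (seg_integralZ _ Si) seg_integral_cst // lerD //.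
      rewrite (@seg_integral_eventually0 _ r X) ?r0 //; first exact: Ai.
      by move=> t /andP[rt _]; rewrite (Aa _ (ltW rt)) subrr taxi0.
    rewrite ler_wpM2l // lerD2l mulrC ler_wpM2r // invr_ge0 mulr_ge0 // ltW //.
  have GX := cprimitive_bound (GP X X0) XX bi.
  have {}GX : taxi (G X - G 0) <= seg_integral b X.
    apply: GX => t /andP[t0 tX]; rewrite /g /b; apply: le_trans (taxiD _ _) _.
    rewrite lerD2l; apply: le_trans (taxiM _ _) _.
    rewrite /K [leRHS](_ : _ = taxi ('i * z * 2) * (2 * (d + (4 * d)^-1 * S t))); last by ring.
    rewrite ler_wpM2l ?taxi_ge0 //; apply: le_trans (taxi_cmod _) _.
    rewrite ler_wpM2l // cmodM (mulrC _ (S t)).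
    by apply: le_trans (yS t); rewrite ler_piMr ?cmod_ge0 ?ez.
  have aX : taxi (a * X%:C) = al * X by rewrite mulrC taxiZ ger0_norm // mulrC.
  have yX : taxi (y X * cexp z X) <= 2 * cmod (y X).
    by apply: le_trans (taxi_cmod _) _; rewrite ler_wpM2l // cmodM ler_piMr ?cmod_ge0 ?ez.
  have := taxiB (y X * cexp z X) (G X - G 0).
  rewrite (_ : _ - _ = a * X%:C); last by rewrite /G y00 !mul0r mulr0 subrr subr0 opprB addrC subrK.
  rewrite aX; move: GX bE yX; lra.
pose C' := C + K * (I / (4 * d)).
have C0 : 0 <= C by apply: seg_integral_ge0 => t _; exact: taxi_ge0.
have C'0 : 0 <= C'.
  by rewrite addr_ge0 // mulr_ge0 // divr_ge0 // mulr_ge0 // ltW.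
(* Beyond this point |y| >= 1, so the integral of |y|^2 over an interval of length I + 1 exceeds its
   total I. *)
pose X1 := r + 2 * (C' + 2) / al.
have X1r : r <= X1 by rewrite lerDl divr_ge0 ?(ltW al0) // mulr_ge0 // addr_ge0.
have X10 := le_trans r0 X1r.
have S1 t : X1 < t -> 1 <= S t.
  move=> Xt; have rt := le_trans X1r (ltW Xt); have := bound t rt.
  have h1 : 2 * (C' + 2) <= al * t.
    by rewrite -ler_pdivrMl //; apply: le_trans (ltW Xt); rewrite /X1 mulrC lerDr.
  have h2 : K * d * t <= al / 2 * t by rewrite ler_wpM2r // (le_trans r0).
  rewrite mulrDr mulrA => h3.
  have {h3} : 1 <= cmod (y t) by rewrite /C' in h1; lra.
  by move=> c1; rewrite /S -cmod_sqr expr_ge1 ?cmod_ge0.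
pose T := X1 + I + 1.
have T0 : 0 <= T by rewrite /T; lra.
have X1T : 0 <= X1 <= T by rewrite X10 /T; lra.
have [ST SIT] := SI T T0.
have : seg_integral (fun t => if X1 < t then 1 else 0) T <= seg_integral S T.
  apply: le_seg_integral => //.
    by apply: seg_integrable_if (seg_integrable_cst T 1); exact: measurable_fun_ltr.
  by move=> t _; case: ifP => // /S1.
rewrite (seg_integral_truncl X1T (seg_integrable_cst T 1)) !seg_integral_cst // !mul1r.
by move=> /le_trans /(_ SIT); rewrite /T; lra.
Qed.

(** A nonzero eigenfunction cannot have slope 0 at the origin, by uniqueness for the Volterra
    equation, so it can be normalised to slope 1. *)
Lemma eigenvalue_boundary_solution (V V' : R -> R[i]) (r : R) lam :
  0 <= r -> (forall X, 0 <= X -> cseg_integrable X V') ->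
  {ae mu, forall t, 0 < t -> V t = V' t} -> (forall t, r < t -> V' t = 0) ->
  is_eigenvalue V lam ->
  exists z F f, [/\ z ^+ 2 = lam /\ 0 <= Im z, F 0 = 0 /\ f 0 = 1,
    cprimitive_on r F f, cprimitive_on r f (fun t => (V' t - lam) * F t) &
    f r = 'i * z * F r].
Proof.
move=> r0 V'i VV' V'0 ev.
have [y [f [[x [x0 yx]] y0 y2 yP]]] := eigen_primitives V'i VV' ev.
have [z zl z0] := sqrtc_upper lam; rewrite -zl in yP *.
have fr := eigen_outgoing r0 V'0 z0 y0 y2 yP.
have f0 : f 0 != 0.
  apply: contraNneq yx => f0; apply/eqP.
  have [P1 P2] := yP x x0.
  apply: (volterra_unique x0 _ P1 P2 y0 f0); last by rewrite x0 lexx.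
  exact: cseg_integrableD (V'i x x0) (cseg_integrable_cst x (- z ^+ 2)).
have [P1 P2] := yP r r0.
exists z, (fun t => (f 0)^-1 * y t), (fun t => (f 0)^-1 * f t); split=> //.
- by rewrite y0 mulr0 mulVf.
- exact: cprimitive_onZ.
- by apply: cprimitive_on_ext (cprimitive_onZ (f 0)^-1 r0 P2) => // t _; rewrite mulrCA.
- by rewrite fr mulrCA.
Qed.

End Eigenfunction.

(** * Counting *)

Section Counting.
Variable R : realType.
Local Notation mu := (@lebesgue_measure R).
Local Notation Re := (@complex.Re R).
Local Notation Im := (@complex.Im R).
Implicit Types (x t X : R) (lam z : R[i]).

Lemma poly_zeros_bound_half (zs : seq R[i]) (c : R[i]) (rho : R) : 0 < rho -> uniq zs ->
  (forall z, z \in zs -> cmod z <= rho) -> cmod c <= rho ->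
  exists2 K : R, 0 <= K & forall (p : {poly R[i]}) (B : R),
    poly_norm p (5 * rho)%:C <= B%:C ->
    cmod p.[c] <= B / 2 ^+ size zs + K * \sum_(z <- zs) cmod p.[z].
Proof.
move=> rho0 uzs zsr cr; have rho0' := ltW rho0.
have [||||||K K0 HK] := @poly_zeros_bound R[i] zs c rho%:C (4 * rho)%:C (2 * rho)%:C.
- by rewrite ltcR mulr_gt0.
- by rewrite lecR.
- by rewrite lecR mulr_ge0.
- exact: uzs.
- move=> z zz; rewrite !cmodE !lecR; split; first exact: zsr.
  by rewrite (le_trans (cmodB _ _)) // mulr_natl mulr2n lerD // zsr.
- by rewrite cmodE -rmorphD lecR; lra.
have KE : K = (Re K)%:C by rewrite RRe_real // ger0_real.
have ReK0 : 0 <= Re K by rewrite -lecR -KE.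
exists (Re K) => // p B pB; have := HK p.
rewrite -rmorphD (_ : rho + 4 * rho = 5 * rho); last by ring.
rewrite -fmorphV -rmorphM (_ : 2 * rho / (4 * rho) = 2^-1); last by field; rewrite gt_eqF.
have -> : \sum_(z <- zs) `|p.[z]| = (\sum_(z <- zs) cmod p.[z])%:C.
  by rewrite rmorph_sum; apply: eq_bigr => z _; rewrite cmodE.
rewrite cmodE KE -rmorphXn -rmorphM /= => h.
have h' : (2^-1 ^+ size zs)%:C * poly_norm p (5 * rho)%:C <= (B / 2 ^+ size zs)%:C.
  have -> : (B / 2 ^+ size zs)%:C = (2^-1 ^+ size zs)%:C * B%:C.
    by rewrite -exprVn mulrC; exact: rmorphM.
  by apply: ler_wpM2l => //; rewrite lecR exprn_ge0 // invr_ge0.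
rewrite -lecR; apply: le_trans h _.
have -> : (B / 2 ^+ size zs + Re K * \sum_(z <- zs) cmod p.[z])%:C =
  (B / 2 ^+ size zs)%:C + (Re K * \sum_(z <- zs) cmod p.[z])%:C by exact: rmorphD.
exact: lerD.
Qed.

Section JostPolynomial.
Variables (V : R -> R[i]) (r : R).

(** The polynomial f_n, an approximation of the Jost function y'(r) - iz y(r). With lam = z^2 the
    term y' fills the even powers of z and -izy the odd ones. *)
Definition jost_poly n : {poly R[i]} :=
  \sum_(j < n) (pcoef' V n j r *: 'X^(j.*2) + (- 'i * pcoef V n j r) *: 'X^(j.*2.+1)).

Lemma jost_polyE n z :
  (jost_poly n).[z] = psol' V n (z ^+ 2) r - 'i * z * psol V n (z ^+ 2) r.
Proof.
rewrite /jost_poly horner_sum /psol /psol' mulr_sumr -sumrB; apply: eq_bigr => j _.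
by rewrite !hornerE /= exprS -mul2n exprM; ring.
Qed.

Lemma jost_poly_norm n (s B B' : R) : 0 <= s ->
  \sum_(j < n) (s ^+ 2) ^+ j * taxi (pcoef V n j r) <= B ->
  \sum_(j < n) (s ^+ 2) ^+ j * taxi (pcoef' V n j r) <= B' ->
  poly_norm (jost_poly n) s%:C <= (B' + s * B)%:C.
Proof.
move=> s0 aB bB'; have s0' : 0 <= s%:C by rewrite lecR.
apply: le_trans (poly_norm_sum _ _ s0') _.
apply: (@le_trans _ _ (\sum_(j < n) ((s ^+ 2) ^+ j * taxi (pcoef' V n j r) +
    s * ((s ^+ 2) ^+ j * taxi (pcoef V n j r)))%:C)).
  apply: ler_sum => j _; apply: le_trans (poly_normD _ _ s0') _.
  rewrite !poly_norm_monomial !cmodE -!rmorphXn -!rmorphM -rmorphD lecR.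
  rewrite mulNr cmodN (cmodM 'i) cmodi mul1r -mul2n exprS exprM.
  apply: lerD.
    by rewrite mulrC ler_wpM2l ?cmod_taxi // exprn_ge0 // exprn_ge0.
  rewrite mulrC -mulrA ler_wpM2l // ler_wpM2l ?cmod_taxi // exprn_ge0 // exprn_ge0 //.
rewrite -rmorph_sum lecR big_split /= lerD // -mulr_sumr ler_wpM2l //.
Qed.

End JostPolynomial.

Lemma cmod_double z : cmod (z + z) = 2 * cmod z.
Proof.
have -> : z + z = 2%:C * z by rewrite rmorph_nat; ring.
by rewrite cmodM cmod_real ger0_norm.
Qed.

(** Of the two square roots, w is the one with |z - w| <= |z + w|. As z + w and z - w add up to 2z,
    this forces |z + w| >= |z|, and their product i g then makes z - w small. *)
Lemma shifted_sqrt z (g rho : R) : 0 < rho -> rho <= cmod z -> 0 <= g ->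
  exists w : R[i], [/\ w ^+ 2 = z ^+ 2 - 'i * g%:C, rho <= cmod (z + w),
    cmod (z - w) * cmod (z + w) = g & cmod (z - w) <= g / rho].
Proof.
move=> rho0 rz g0.
have [w w2 wz] : exists2 w, w ^+ 2 = z ^+ 2 - 'i * g%:C & cmod (z - w) <= cmod (z + w).
  set u := sqrtc (z ^+ 2 - 'i * g%:C); have u2 : u ^+ 2 = z ^+ 2 - 'i * g%:C by rewrite sqr_sqrtc.
  have [h|/ltW h] := leP (cmod (z - u)) (cmod (z + u)); first by exists u.
  by exists (- u); rewrite ?sqrrN // opprK.
have zw : rho <= cmod (z + w).
  have := cmodD (z + w) (z - w); rewrite addrACA subrr addr0 cmod_double; lra.
have prod : cmod (z - w) * cmod (z + w) = g.
  rewrite -cmodM -subr_sqr w2 opprB addrCA subrr addr0 cmodM cmodi mul1r cmod_real.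
  by rewrite ger0_norm.
exists w; split=> //; rewrite ler_pdivlMr // -prod ler_wpM2l ?cmod_ge0 //.
Qed.

(* In the end rho = 2 g r / ln r, so that expR (2 * eta * r) = r. *)
Section FixedRadius.
Variables (g Q r rho : R) (q : R -> R[i]).
Let nq := seg_integral (fun t => taxi (q t)) r.
Let eta := g / rho.
Let V := HR_potential q g r.
Hypotheses (g0 : 0 < g) (r0 : 0 <= r).
Hypotheses (qi : cseg_integrable r q) (qQ : forall t, Q < t -> q t = 0).
Hypotheses (rho4 : 4 <= rho) (rhog : g <= rho) (rhoQ : 4 * g * Q <= rho)
  (rhoq : 40 * nq + 4 <= rho).
Hypotheses (barrier : 12 * g * expR (2 * eta * r) <= rho ^+ 2).

Let rho0 : 0 < rho. Proof. exact: lt_le_trans rho4. Qed.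

Let eta0 : 0 <= eta. Proof. by rewrite divr_ge0 ?ltW. Qed.

Let eta1 : eta <= 1. Proof. by rewrite /eta ler_pdivrMr // mul1r. Qed.

Let nq0 : 0 <= nq. Proof. by apply: seg_integral_ge0 => t _; exact: taxi_ge0. Qed.

Let VE t : 0 <= t <= r -> V t = q t + 'i * g%:C.
Proof. by move=> tr; rewrite /V /HR_potential /chi tr mulr1. Qed.

Let Vi : cseg_integrable r V.
Proof.
have [a b] := cseg_integrableD qi (cseg_integrable_cst r ('i * g%:C)).
by split; [apply: seg_integrable_ext a|apply: seg_integrable_ext b] => t;
  rewrite inE => tr; rewrite VE.
Qed.

Let etaQ : expR (2 * eta * Q) <= 2.
Proof.
have h : 2 * eta * Q <= 1 / 2.
  rewrite /eta mulrA mulrAC ler_pdivrMr //; have := rhoQ; lra.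
apply: (@le_trans _ _ (expR (1 / 2))); first by rewrite ler_expR.
(* 1/2 <= e^(-1/2), that is e^(1/2) <= 2. *)
have := expR_ge1Dx (- (1 / 2) : R); rewrite expRN => h2.
have h3 : 0 < expR (1 / 2 : R) by exact: expR_gt0.
have : 1 / 2 * expR (1 / 2) <= 1 :> R.
  rewrite -[leRHS](mulVf (lt0r_neq0 h3)) ler_wpM2r ?expR_ge0 //.
  by apply: le_trans h2; lra.
lra.
Qed.

(** On [0, r] the barrier is absorbed into w. At least |z + w| / 4 is left of the main term, |z + w|
    and |w| are comparable to |z|, and Im w >= Im z - eta. Keeping h apart from F serves exact
    solutions and iterates alike. *)
Lemma jost_lower_bound z (eps : R) (h F f : R -> R[i]) :
  rho <= cmod z -> 0 <= Im z ->
  cprimitive_on r F f -> cprimitive_on r f (fun t => (V t - z ^+ 2) * h t) ->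
  F 0 = 0 -> f 0 = 1 -> 0 <= eps ->
  (forall t, 0 <= t <= r -> taxi (h t - F t) <= eps) ->
  32 * expR r * eps * (nq + (taxi (z ^+ 2) + g) * r) <= 1 ->
  cmod z * expR ((Im z - eta) * r) <= 16 * (cmod z + 1) * cmod (f r - 'i * z * F r).
Proof.
move=> rz z0 FP fP F0 f0 eps0 Fh small.
have [w [w2 zw prod wz]] := shifted_sqrt rho0 rz (ltW g0).
have Imw : Im z - eta <= Im w.
  have := Im_cmod (z - w); rewrite raddfB /= => /ler_normlP [_]; rewrite /eta; lra.
have wl : cmod z - 1 <= cmod w.
  have := cmodBr z (z - w); rewrite opprB addrCA subrr addr0; have := eta1; rewrite /eta; lra.
have wu : cmod w <= cmod z + 1.
  have := cmodB z (z - w); rewrite opprB addrCA subrr addr0; have := eta1; rewrite /eta; lra.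
have w0 : 0 < cmod w by have := rho4; lra.
have wq : 40 * nq <= cmod w by have := rhoq; lra.
have fP' : cprimitive_on r f (fun t => (q t - w ^+ 2) * h t).
  by apply: cprimitive_on_ext fP => // t tr; rewrite VE // w2; ring.
have Imw' : - eta <= Im w by lra.
have small' : 32 * expR (eta * r) * eps *
    seg_integral (fun t => taxi (q t) + taxi (w ^+ 2)) r <= 1.
  apply: le_trans _ small.
  rewrite (seg_integralD (taxi_integrable qi) (seg_integrable_cst _ _)) seg_integral_cst // -/nq.
  have tw : taxi (w ^+ 2) <= taxi (z ^+ 2) + g.
    rewrite w2; apply: le_trans (taxiB _ _) _; rewrite lerD2l.
    by rewrite /taxi /= !mul0r mulr0 mul1r subr0 add0r normr0 add0r ger0_norm // ltW.
  have er : expR (eta * r) <= expR r by rewrite ler_expR ler_piMl.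
  apply: ler_pM.
  - by rewrite !mulr_ge0 ?expR_ge0.
  - by rewrite addr_ge0 // mulr_ge0 // taxi_ge0.
  - by rewrite ler_wpM2r // ler_wpM2l.
  - by rewrite lerD2l ler_wpM2r.
have := large_energy_bound r0 qi eta0 Imw' qQ etaQ w0 wq FP fP' F0 f0 eps0 Fh small' z.
set ex := expR (2 * eta * r); set J := cmod (f r - _) => main.
(* Multiplied by |z + w|, where |z - w| |z + w| = g, this reads 12 g e^(2 eta r) <= |z + w|^2 and
   follows from [barrier]. *)
have h1 : 3 * cmod (z - w) * ex <= cmod (z + w) / 4.
  have zw0 : 0 < cmod (z + w) by have := rho0; lra.
  rewrite -(ler_pM2r zw0).
  rewrite [leLHS](_ : _ = 3 * (cmod (z - w) * cmod (z + w)) * ex); last by ring.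
  rewrite prod.
  have : rho ^+ 2 <= cmod (z + w) ^+ 2 by rewrite ler_pXn2r ?nnegrE ?cmod_ge0 ?(ltW rho0).
  have := barrier; rewrite -/ex; lra.
have zw2 : 2 * cmod z - 1 <= cmod (z + w).
  have := cmodD (z + w) (z - w); rewrite addrACA subrr addr0 cmod_double.
  have := eta1; rewrite /eta; lra.
have zpos : 4 <= cmod z by have := rho4; lra.
have J0 : 0 <= J by exact: cmod_ge0.
have h2 : cmod z <= 16 * (cmod z + 1) * J * expR (- (Im w * r)).
  have e0 : 0 <= expR (- (Im w * r)) by exact: expR_ge0.
  have : 2 * cmod w * J * expR (- (Im w * r)) <= 2 * (cmod z + 1) * J * expR (- (Im w * r)).
    by rewrite !ler_wpM2r // ler_wpM2l.
  lra.
have h3 : expR ((Im z - eta) * r) * expR (- (Im w * r)) <= 1.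
  rewrite -expRD -[leRHS]expR0 ler_expR.
  have : (Im z - eta) * r <= Im w * r by rewrite ler_wpM2r.
  lra.
have e0 : 0 <= expR ((Im z - eta) * r) by exact: expR_ge0.
apply: le_trans (ler_wpM2r e0 h2) _.
have c0 : 0 <= 16 * (cmod z + 1) * J by rewrite !mulr_ge0 // addr_ge0 ?cmod_ge0.
by rewrite -[leLHS]mulrA -[leRHS]mulr1 ler_wpM2l // mulrC.
Qed.

(** For h = F and eps = 0 the lower bound is positive, whereas the boundary condition makes the
    quantity it bounds vanish. *)
Lemma eigenvalue_small z F f :
  cprimitive_on r F f -> cprimitive_on r f (fun t => (V t - z ^+ 2) * F t) ->
  F 0 = 0 -> f 0 = 1 -> 0 <= Im z -> f r = 'i * z * F r -> cmod z < rho.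
Proof.
move=> FP fP F0 f0 z0 fr; case: (ltP (cmod z) rho) => // rz.
have := @jost_lower_bound z 0 F F f rz z0 FP fP F0 f0 (lexx _).
rewrite mulr0 mul0r ler01 fr subrr cmod0 mulr0 => /(_ _ isT) H.
have : cmod z * expR ((Im z - eta) * r) <= 0.
  by apply: H => t _; rewrite subrr taxi0.
have pos : 0 < cmod z * expR ((Im z - eta) * r) by rewrite mulr_gt0 ?expR_gt0 // (lt_le_trans rho0).
by rewrite leNgt pos.
Qed.

Lemma eigenvalue_jost_root z F f (e : R) :
  cprimitive_on r F f -> cprimitive_on r f (fun t => (V t - z ^+ 2) * F t) ->
  F 0 = 0 -> f 0 = 1 -> f r = 'i * z * F r -> 0 < e ->
  exists N, forall n, (N <= n)%N -> cmod (jost_poly V r n).[z] <= e.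
Proof.
move=> FP fP F0 f0 fr e0; pose B := 1 + taxi ('i * z).
have B0 : 0 < B by rewrite ltr_wpDr ?taxi_ge0.
have [N HN] := psol_cvg r0 Vi FP fP F0 f0 (divr_gt0 e0 B0).
exists N => n /HN [h1 h2]; rewrite jost_polyE.
rewrite [X in cmod X](_ : _ = 'i * z * (F r - psol V n (z ^+ 2) r) -
  (f r - psol' V n (z ^+ 2) r)); last by rewrite fr; ring.
apply: le_trans (cmod_taxi _) _; apply: le_trans (taxiB _ _) _.
apply: (@le_trans _ _ (taxi ('i * z) * (e / B) + e / B)).
  apply: lerD => //; apply: le_trans (taxiM _ _) _.
  by rewrite ler_wpM2l ?taxi_ge0.
rewrite [leLHS](_ : _ = e) //; rewrite /B; field; rewrite -/B gt_eqF //.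
Qed.

(** The lower bound at z = i rho is applied to iterate n + 1, with iterate n as h. The factor 32 is
    16 (rho + 1) / rho rounded up. *)
Lemma jost_poly_large : exists N, forall n, (N <= n)%N ->
  expR ((rho - eta) * r) <= 32 * cmod (jost_poly V r n).['i * rho%:C].
Proof.
pose z : R[i] := 'i * rho%:C.
have cz : cmod z = rho by rewrite cmodM cmodi mul1r cmod_real ger0_norm // ltW.
have Iz : Im z = rho by rewrite /z /= mul0r mul1r add0r.
(* A defect of 1/B is exactly small enough for the last condition of the lower bound; the 1 makes B
   positive. *)
pose B := 1 + 32 * expR r * (nq + (taxi (z ^+ 2) + g) * r).
have B0 : 0 < B.
  rewrite ltr_wpDr // !mulr_ge0 ?expR_ge0 // addr_ge0 // mulr_ge0 // addr_ge0 ?taxi_ge0 //.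
  exact: ltW.
have e0 : 0 < B^-1 by rewrite invr_gt0.
have [N HN] := psol_cauchy r0 Vi (z ^+ 2) e0.
exists N.+1 => -[//|n] /HN h.
have [P1 P2] := psol_primitive r0 Vi n (z ^+ 2).
have := @jost_lower_bound z B^-1 (psol V n (z ^+ 2)) (psol V n.+1 (z ^+ 2))
  (psol' V n.+1 (z ^+ 2)) _ _ P1 P2 (psol_at0 _ _ _) (psol'_at0 _ _ _) (ltW e0) h.
rewrite cz Iz -jost_polyE lexx ltW // => /(_ isT isT) H.
have {}H := H _; have /H : 32 * expR r * B^-1 * (nq + (taxi (z ^+ 2) + g) * r) <= 1.
  rewrite mulrAC ler_pdivrMr // mul1r /B lerDr //.
set J := cmod _; have J0 : 0 <= J by exact: cmod_ge0.
move=> h1; rewrite -(ler_pM2l rho0); apply: le_trans h1 _.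
have : 0 <= (rho - 1) * J by rewrite mulr_ge0 //; have := rho4; lra.
lra.
Qed.

Lemma jost_poly_majorant n : poly_norm (jost_poly V r n) (5 * rho)%:C <=
  (41 / 4 * rho * expR (21 / 4 * rho * r))%:C.
Proof.
(* The rate must slightly exceed 5 rho, the square root of the weight on lam; the excess rho / 4
   pays for the initial slope, the L^1 norm of q and the height g. The prefactor 41/4 is 21/4 from
   y' plus 5 from zy. *)
pose k := 21 / 4 * rho; have k0 : 0 < k by rewrite mulr_gt0.
have VQ t : 0 <= t <= r -> taxi (V t) <= taxi (q t) + g.
  move=> tr; rewrite VE //; apply: le_trans (taxiD _ _) _; rewrite lerD2l.
  by rewrite /taxi /= !mul0r mulr0 mul1r subr0 add0r normr0 add0r ger0_norm // ltW.
have kbig : 1 + nq + (g + (5 * rho) ^+ 2) / k <= k.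
  rewrite -lerBrDl ler_pdivrMr //.
  have h1 : 99 / 20 * rho <= k - (1 + nq) by have := rhoq; have := rho4; rewrite /k; lra.
  apply: le_trans (ler_wpM2r (ltW k0) h1).
  have : 4 * rho <= rho * rho by rewrite ler_pM2r.
  have := rhog; have := rho4; rewrite /k; lra.
have rr : 0 <= r <= r by rewrite r0 lexx.
have [aB bB] := picard_majorant r0 Vi (fun t => taxi_ge0 (q t)) (taxi_integrable qi) (ltW g0)
  (sqr_ge0 _) k0 VQ kbig n rr.
have s0 : 0 <= 5 * rho by rewrite mulr_ge0 // ltW.
apply: le_trans (jost_poly_norm s0 aB bB) _.
by rewrite lecR -/k -mulrDl ler_wpM2r ?expR_ge0 // /k; lra.
Qed.

Definition boundary_solution z := exists F f, [/\ 0 <= Im z, F 0 = 0 /\ f 0 = 1,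
  cprimitive_on r F f, cprimitive_on r f (fun t => (V t - z ^+ 2) * F t) &
  f r = 'i * z * F r].

Lemma sum_eventually_small (T : eqType) (h : nat -> T -> R) (zs : seq T) :
  (forall y : T, y \in zs -> forall e, 0 < e ->
    exists N, forall n, (N <= n)%N -> h n y <= e) ->
  forall e, 0 < e -> exists N, forall n, (N <= n)%N -> \sum_(z <- zs) h n z <= e.
Proof.
elim: zs => [_ e e0|z zs IH H e e0].
  by exists 0%N => n _; rewrite big_nil ltW.
have [N1 H1] := H z (mem_head _ _) _ (divr_gt0 e0 (ltr0Sn R 1)).
have [|N2 H2] := IH _ _ (divr_gt0 e0 (ltr0Sn R 1)).
  by move=> y yzs; apply: H; rewrite inE yzs orbT.
exists (maxn N1 N2) => n; rewrite geq_max => /andP[n1 n2].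
by rewrite big_cons (splitr e) lerD ?H1 ?H2.
Qed.

(* All roots lie in |z| <= rho; with centre c = i rho and weight 5 rho, each of
   them costs a factor 2 rho / (4 rho) = 1/2. *)
Lemma boundary_solution_count (zs : seq R[i]) : 328 <= r -> uniq zs ->
  (forall z, z \in zs -> boundary_solution z) ->
  (size zs)%:R * ln 2 <= 11 / 2 * rho * r.
Proof.
move=> r328 uzs zsP.
have zsr z : z \in zs -> cmod z <= rho.
  by move=> /zsP[F [f [z0 [F0 f0] P1 P2 fr]]]; rewrite ltW // (eigenvalue_small P1 P2).
pose c : R[i] := 'i * rho%:C.
have cr : cmod c <= rho by rewrite cmodM cmodi mul1r cmod_real ger0_norm // ltW.
have [K K0 HK] := poly_zeros_bound_half rho0 uzs zsr cr.
have small := @sum_eventually_small _ (fun n z => cmod (jost_poly V r n).[z]) zs.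
have {}small : forall e, 0 < e -> exists N, forall n, (N <= n)%N ->
    \sum_(z <- zs) cmod (jost_poly V r n).[z] <= e.
  apply: small => z /zsP[F [f [z0 [F0 f0] P1 P2 fr]]] e e0.
  exact: (eigenvalue_jost_root P1 P2).
pose B := 41 / 4 * rho * expR (21 / 4 * rho * r).
have [N1 H1] := jost_poly_large.
have key : expR ((rho - eta) * r) <= 32 * (B / 2 ^+ size zs).
  apply/ler_addgt0Pr => e e0.
  (* K does not depend on n, so n can be taken large after it; K + 1 replaces K because K may be
     0. *)
  have K1 : 0 < 32 * (K + 1) by rewrite mulr_gt0 // ltr_wpDl.
  have [N2 H2] := small _ (divr_gt0 e0 K1).
  pose n := maxn N1 N2.
  apply: le_trans (H1 n (leq_maxl _ _)) _.
  have h2 := HK _ _ (jost_poly_majorant n).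
  have h3 := H2 n (leq_maxr _ _).
  apply: (@le_trans _ _ (32 * (B / 2 ^+ size zs + K * (e / (32 * (K + 1)))))).
    rewrite ler_wpM2l //; apply: le_trans h2 _; rewrite lerD2l ler_wpM2l //.
  rewrite mulrDr lerD2l (_ : 32 * _ = e * (K / (K + 1))); last first.
    by field; rewrite gt_eqF // ltr_wpDl.
  by rewrite -[leRHS]mulr1 ler_wpM2l ?(ltW e0) // ler_pdivrMr ?mul1r ?ltr_wpDl // lerDl.
have two : 0 < 2 ^+ size zs :> R by rewrite exprn_gt0.
have pow : 2 ^+ size zs <= expR (11 / 2 * rho * r).
  have E0 : 0 < expR ((rho - eta) * r) by exact: expR_gt0.
  rewrite -(ler_pM2r E0) mulrC.
  move: key; rewrite mulrA ler_pdivlMr // => /le_trans; apply.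
  (* 328 = 32 * 41/4. The growth e^(rho r) at i rho cancels this prefactor, and e^(eta r) <= e^(rho
     r / 4) raises 21/4 to 11/2. *)
  have h1 : 328 * rho <= expR (rho * r).
    apply: le_trans (expR_ge1Dx _); rewrite ler_wpDl // mulrC ler_wpM2l // ltW //.
  rewrite /B (_ : 32 * _ = 328 * rho * expR (21 / 4 * rho * r)); last by field.
  apply: (le_trans (ler_wpM2r (expR_ge0 _) h1)); rewrite -!expRD ler_expR.
  have : eta * r <= 1 * r by rewrite ler_wpM2r.
  have : 4 * r <= rho * r by rewrite ler_wpM2r.
  lra.
by rewrite mulr_natl -lnXn // -[leRHS]expRK ler_ln ?posrE ?expR_gt0.
Qed.

End FixedRadius.
End Counting.

(** * Size of rho = 2 g r / ln r for large r *)

Section Asymptotics.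
Variable R : realType.
Implicit Types (r g M Q : R).

Lemma radius_asymptotics g M Q : 0 < g ->
  exists2 R0, 0 < R0 & forall r, R0 <= r ->
    [/\ 328 <= r, Q <= r, 0 < ln r, M <= 2 * g * r / ln r &
        12 * g * r <= (2 * g * r / ln r) ^+ 2].
Proof.
move=> g0; pose B := 328 + `|Q| + 2 * `|M| / g + 48 / g.
have Qn : 0 <= `|Q| by [].
have Mg : 0 <= 2 * `|M| / g by rewrite divr_ge0 ?mulr_ge0 // ltW.
have gg : 0 <= 48 / g by rewrite divr_ge0 // ltW.
have B328 : 328 <= B by rewrite /B; lra.
have B0 : 0 < B by lra.
exists (B ^+ 4); first by rewrite exprn_gt0.
move=> r Br; have r0 : 0 <= r by rewrite (le_trans _ Br) // exprn_ge0 // ltW.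
(* With v = r^(1/4) one has ln r = 4 ln v <= 4 v, hence rho >= g v^3 / 2. The last claim then needs
   g v^2 >= 48, which holds for large v; a square root in place of v would only give rho^2 >= g^2 r,
   too little for small g. *)
pose v := Num.sqrt (Num.sqrt r).
have v0 : 0 <= v by rewrite sqrtr_ge0.
have vr : r = v ^+ 4.
  by rewrite (exprM v 2 2) /v sqr_sqrtr ?sqrtr_ge0 // sqr_sqrtr.
have Bv : B <= v by rewrite -(@ler_pXn2r _ 4) ?nnegrE ?(ltW B0) // -vr.
have v1 : 1 <= v by lra.
have v0' : 0 < v by lra.
have rv : v <= r.
  by rewrite vr -[leLHS]expr1 ler_weXn2l.
have L0 : 0 < ln r by rewrite ln_gt0 //; lra.
have L4 : ln r <= 4 * v.
  have -> : ln r = 4 * ln v by rewrite {1}vr lnXn // mulr_natl.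
  rewrite ler_wpM2l //.
  have := @le_ln1Dx R (v - 1); rewrite addrCA subrr addr0 => h.
  by apply: le_trans (h _) _; lra.
have rho : g * v ^+ 3 / 2 <= 2 * g * r / ln r.
  rewrite ler_pdivlMr //.
  have : g * v ^+ 3 / 2 * ln r <= g * v ^+ 3 / 2 * (4 * v).
    by rewrite ler_wpM2l // divr_ge0 // mulr_ge0 ?exprn_ge0 // ltW.
  move=> /le_trans; apply; rewrite vr; lra.
have gv : 2 * `|M| <= g * v.
  have : 2 * `|M| / g <= v by apply: le_trans Bv; rewrite /B; lra.
  by rewrite ler_pdivrMr // (mulrC v).
have gv48 : 48 <= g * v.
  have : 48 / g <= v by apply: le_trans Bv; rewrite /B; lra.
  by rewrite ler_pdivrMr // (mulrC v).
have gv0 : 0 <= g * v by rewrite mulr_ge0 // ltW.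
split=> //.
- lra.
- apply: le_trans (ler_norm Q) _; apply: le_trans rv; apply: le_trans Bv; rewrite /B; lra.
- apply: le_trans (ler_norm M) _; apply: le_trans rho.
  have : g * v <= g * v * v ^+ 2 by rewrite ler_peMr // exprn_ege1.
  by lra.
- have h : g * v ^+ 3 / 2 >= 0 by rewrite divr_ge0 // mulr_ge0 ?exprn_ge0 // ltW.
  apply: (@le_trans _ _ ((g * v ^+ 3 / 2) ^+ 2)); last first.
    by rewrite ler_pXn2r // nnegrE // (le_trans h).
  have : 48 * (g * v ^+ 4) <= (g * v) * v * (g * v ^+ 4).
    rewrite ler_wpM2r ?mulr_ge0 ?exprn_ge0 ?(ltW g0) //.
    by apply: le_trans gv48 _; rewrite ler_peMr.
  rewrite vr; lra.
Qed.

End Asymptotics.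

(** * A representative of q with support in [0, Q] *)

Section Cutoff.
Variable R : realType.
Local Notation mu := (@lebesgue_measure R).
Implicit Types (q : R -> R[i]) (Q X : R).

(** The hypotheses say nothing about q at t <= 0 and describe its support only almost everywhere,
    whereas the estimates use closed segments [0, x] and exact vanishing beyond Q. *)
Definition cutoff q Q (t : R) : R[i] := if (0 < t) && (t <= Q) then q t else 0.

Lemma cutoff_integrable q Q X : cintegrable [set t : R | 0 < t] q ->
  cseg_integrable X (cutoff q Q).
Proof.
have part (p : R[i] -> R) : p 0 = 0 -> mu.-integrable [set t : R | 0 < t] (fun t => (p (q t))%:E) ->
    seg_integrable X (fun t => p (cutoff q Q t)).
  move=> p0 pi.
  have mI : measurable (`]0, Q] : set (measurableTypeR R)) by [].
  have : mu.-integrable `]0, Q] (fun t => (p (q t))%:E).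
    apply: integrableS pi => //.
      rewrite (_ : [set t : R | 0 < t] = `]0, +oo[%classic) //.
      by apply/seteqP; split => t /=; rewrite in_itv /= andbT.
    by move=> t /=; rewrite in_itv /= => /andP[].
  move=> /(integrable_mkcond _ mI) /(integrableS measurableT (measurable_seg X) (@subsetT _ _)).
  apply: eq_integrable => // t _.
  by rewrite /patch mem_setE in_itv /cutoff; case: ifP => //; rewrite p0.
by move=> [qr qi]; split; apply: part.
Qed.

End Cutoff.

Theorem mainTheorem7 (R : realType) (gamma : R) (q : R -> R[i]) :
  0 < gamma ->
  cintegrable [set t : R | 0 < t] q ->
  (exists Q : R, 0 < Q /\
     {ae @lebesgue_measure R, forall t, 0 < t -> Q < t -> q t = 0}) ->
  exists R0 : R, 0 < R0 /\
    forall r : R, R0 <= r ->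
      num_eigenvalues_le (HR_potential q gamma r)
        ((11 / ln 2) * (gamma * r ^+ 2 / ln r)).
Proof.
move=> g0 qi [Q [Q0 qQ]].
pose p := cutoff q Q.
have pi X : cseg_integrable X p by exact: cutoff_integrable.
have p0 t : Q < t -> p t = 0 by move=> Qt; rewrite /p /cutoff leNgt Qt andbF.
pose n := seg_integral (fun t => taxi (p t)) Q.
have n0 : 0 <= n by apply: seg_integral_ge0 => t _; exact: taxi_ge0.
have gQ : 0 <= 4 * gamma * Q by rewrite !mulr_ge0 // ltW.
(* The sum dominates each lower bound required of rho: 4, gamma, 4 gamma Q and 40 n + 4. As n is the
   norm on [0, Q], the threshold is fixed before r. *)
have [R0 R00 HR] := radius_asymptotics (4 + gamma + 4 * gamma * Q + 40 * n) Q g0.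
exists R0; split=> // r /HR [r328 Qr L0 rhoM rho2] s us sev.
set rho := 2 * gamma * r / ln r in rhoM rho2.
have r0 : 0 <= r by lra.
have rn : seg_integral (fun t => taxi (p t)) r = n.
  apply: seg_integral_eventually0; first by rewrite ltW.
    exact: taxi_integrable.
  by move=> t /andP[Qt _]; rewrite p0 // taxi0.
have rho0 : 0 < rho by lra.
(* The choice of rho makes 2 gamma r / rho equal to ln r, so the barrier condition becomes 12 gamma
   r <= rho^2. *)
have rE : expR (2 * (gamma / rho) * r) = r.
  rewrite (_ : 2 * _ * r = ln r) ?lnK ?posrE //; first by lra.
  by rewrite /rho; field; rewrite !gt_eqF //; lra.
pose V := HR_potential p gamma r.
have Vi X : 0 <= X -> cseg_integrable X V.
  move=> X0; have [pr pim] := pi X; split.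
    apply: seg_integrable_ext pr => t _.
    by rewrite /V /HR_potential raddfD /= !mul0r mul1r oppr0 addr0 addr0.
  have := seg_integrableD pim (seg_integrable_if (P := fun t => t <= r)
    (measurable_fun_ler (@measurable_id _ _ _) (@measurable_cst _ _ _ _ _ _)) (seg_integrable_cst X gamma)).
  apply: seg_integrable_ext => t; rewrite inE => /andP[t0 _].
  rewrite /V /HR_potential raddfD /= mul0r mul1r add0r /chi t0 /=.
  by case: ifP; rewrite ?mulr1 ?mulr0.
have V0 t : r < t -> V t = 0.
  move=> rt; rewrite /V /HR_potential p0 ?(le_lt_trans Qr) //.
  by rewrite /chi (leNgt t r) rt andbF mulr0 mulr0 addr0.
have VV : {ae @lebesgue_measure R, forall t, 0 < t -> HR_potential q gamma r t = V t}.
  move: qQ; apply: negligibleS => t /=; apply: contra_not => qt t0.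
  rewrite /V /HR_potential /p /cutoff t0 /=; case: leP => // Qt.
  by rewrite qt.
(* One square root z is chosen for each eigenvalue; distinct eigenvalues have distinct roots because
   squaring recovers them. *)
have [zs zsE zsP] : exists2 zs, [seq z ^+ 2 | z <- zs] = s &
    forall z, z \in zs -> boundary_solution gamma r p z.
  elim: s us sev => [_ _|lam s IH /= /andP[_ us] sev]; first by exists [::].
  have [|zs zsE zsP] := IH us.
    by move=> y ys; apply: sev; rewrite inE ys orbT.
  have [z [F [f [[zl z0] F0 P1 P2 fr]]]] :=
    eigenvalue_boundary_solution r0 Vi VV V0 (sev lam (mem_head _ _)).
  exists (z :: zs); first by rewrite /= zl zsE.
  move=> y; rewrite inE => /predU1P[->|/zsP //].
  by exists F, f; split=> //; rewrite zl.
have uzs : uniq zs by apply: (@map_uniq _ _ (fun z => z ^+ 2)); rewrite zsE.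
have := @boundary_solution_count R gamma Q r rho p g0 r0 (pi r) p0.
rewrite rn rE => H.
have {}H : (size zs)%:R * ln 2 <= 11 / 2 * rho * r by apply: H => //; lra.
have l2 : 0 < ln 2 :> R by rewrite ln_gt0 // ltr1n.
rewrite (_ : size s = size zs); last by rewrite -zsE size_map.
(* 11/2 times the factor 2 in rho is the constant 11. *)
rewrite [leRHS](_ : _ = (11 / 2 * rho * r) / ln 2); last first.
  by rewrite /rho; field; rewrite !gt_eqF.
by rewrite ler_pdivlMr.
Qed.
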